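(* Let $0<\eta\le 1$ and suppose that for each sufficiently large $k$, $(p_k,q_k)$ is a pair of homogeneous polynomials of degree $k$ in two complex variables such that $(p_k,q_k)$ maps the unit sphere $S^3\subset\mathbb{C}^2$ into the annulus $\{w\in\mathbb{C}^2:\sqrt{\eta}\le|w|\le1\}$. Let $F_k=p_k/q_k:\mathbb{CP}^1\to\mathbb{CP}^1$, a rational map of degree $k$. Then for every point $w\in\mathbb{CP}^1$ there is a constant $C$ such that for all sufficiently large $k$ and every $\mathcal{C}^2$ function $f$ on $S^2$, $$\left|\frac{1}{k}\sum_{i=1}^k f(x_i^k)-\frac{1}{|S^2|}\int_{S^2} f\right|\le \frac{C\,\|\triangle f\|_\infty}{k},$$ where $x_1^k,\dots,x_k^k$ are the points of the fiber $F_k^{-1}(w)$ counted with multiplicity. In particular the left-hand side tends to $0$ as $k\to\infty$.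
   Context: $S^2$ is identified with $\mathbb{CP}^1$ and carries the round (Fubini–Study) metric, in the affine coordinate $z$ given by $2\,|dz|^2/(1+|z|^2)^2$ up to the standard normalization, with total area $|S^2|=4\pi$; $\triangle$ is the Laplacian and $\int_{S^2}$ the integral with respect to this metric. *)

(* Defs.v *)
From HB Require Import structures.
From mathcomp Require Import all_boot all_order all_algebra.
From mathcomp Require Import all_classical all_reals all_analysis.
From mathcomp Require Import complex.
From mathcomp Require Import topology normedtype derive lebesgue_measure lebesgue_integral trigo.
Import numFieldNormedType.Exports.
Set Implicit Arguments. Unset Strict Implicit. Unset Printing Implicit Defensive.
Import Order.TTheory GRing.Theory Num.Theory.
Local Open Scope ring_scope.
Local Open Scope classical_set_scope.

Section S2Defs.
Variable R : realType.

Definition sqmod (z : R[i]) : R := (complex.Re z) ^+ 2 + (complex.Im z) ^+ 2.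

(* A homogeneous polynomial of degree k in (z0, z1), encoded by the
   univariate polynomial P (with size P <= k+1) of its coefficients:
   homog k P z0 z1 = sum_{j<=k} P_j z0^j z1^(k-j).
   Its dehomogenisation P(z) = homog k P z 1 is P itself. *)
Definition homog (k : nat) (P : {poly R[i]}) (z0 z1 : R[i]) : R[i] :=
  \sum_(j < k.+1) P`_j * z0 ^+ j * z1 ^+ (k - j).

Definition pdx (g : R -> R -> R) : R -> R -> R :=
  fun x y => (fun t => g t y)^`() x.
Definition pdy (g : R -> R -> R) : R -> R -> R :=
  fun x y => (fun t => g x t)^`() y.

Definition has_partials (g : R -> R -> R) : Prop :=
  forall x y, derivable (fun t => g t y) x 1 /\ derivable (fun t => g x t) y 1.

Definition jcont (h : R -> R -> R) : Prop :=
  forall p : (R * R)%type, {for p, continuous (fun q : (R * R)%type => h q.1 q.2)}.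

Definition C2 (g : R -> R -> R) : Prop :=
  has_partials g /\ has_partials (pdx g) /\ has_partials (pdy g) /\
  jcont g /\ jcont (pdx g) /\ jcont (pdy g) /\
  jcont (pdx (pdx g)) /\ jcont (pdy (pdx g)) /\ jcont (pdx (pdy g)) /\
  jcont (pdy (pdy g)).

(* A real function f on S^2 = CP^1 = C u {oo} is given by its expression
   fa in the affine coordinate z = x + i y, together with its value finf
   at oo.  The second chart is w = 1/z, w = u + i v. *)
Definition chart_inf (fa : R -> R -> R) (finf : R) : R -> R -> R :=
  fun u v => if (u == 0) && (v == 0) then finf
             else fa (u / (u ^+ 2 + v ^+ 2)) (- v / (u ^+ 2 + v ^+ 2)).

Definition C2_sphere (fa : R -> R -> R) (finf : R) : Prop :=
  C2 fa /\ C2 (chart_inf fa finf).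

(* Laplace-Beltrami operator of the round metric 4|dz|^2/(1+|z|^2)^2
   (total area 4 pi), in the affine chart. *)
Definition lap_sphere (fa : R -> R -> R) (x y : R) : R :=
  (1 + x ^+ 2 + y ^+ 2) ^+ 2 / 4 * (pdx (pdx fa) x y + pdy (pdy fa) x y).

(* integral over S^2 w.r.t. the round area measure, computed in the affine
   chart (the point oo has measure zero). *)
Definition sphere_integral (fa : R -> R -> R) : R :=
  Rintegral ((@lebesgue_measure R) \x (@lebesgue_measure R))%E setT
    (fun p : (R * R)%type => fa p.1 p.2 * (4 / (1 + p.1 ^+ 2 + p.2 ^+ 2) ^+ 2)).

(* The fiber F^{-1}(w) of F = p/q, w in CP^1 = option C (None = oo), is the
   zero set in CP^1 of the degree-k homogeneous polynomial p - w q
   (resp. q when w = oo), given here by its dehomogenisation. *)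
Definition fiber_poly (P Q : {poly R[i]}) (w : option R[i]) : {poly R[i]} :=
  match w with Some a => P - a%:P * Q | None => Q end.

(* Sum of f over the fiber counted with multiplicity, where rs are the
   finite zeros (with multiplicity) of the dehomogenised polynomial and
   oo has multiplicity k - size rs. *)
Definition fiber_sum (k : nat) (fa : R -> R -> R) (finf : R) (rs : seq R[i]) : R :=
  \sum_(r <- rs) fa (complex.Re r) (complex.Im r) + (k - size rs)%:R * finf.

End S2Defs.

(* Main.v *)
Require Import Defs.
From HB Require Import structures.
From mathcomp Require Import all_boot all_order all_algebra.
From mathcomp Require Import all_classical all_reals all_analysis.
From mathcomp Require Import complex.
From mathcomp Require Import topology normedtype derive lebesgue_measure lebesgue_integral trigo.
From mathcomp Require Import measurable_realfun ring lra.
Import numFieldNormedType.Exports.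
Import Order.TTheory GRing.Theory Num.Theory.
Set Implicit Arguments. Unset Strict Implicit. Unset Printing Implicit Defensive.
Local Open Scope ring_scope.
Local Open Scope classical_set_scope.

(* Put [k = deg F], [dA = 4 dx dy / (1 + |z|^2)^2] and let [H] be the
   dehomogenisation of [p - w q] (of [q] if [w = oo]).  Choose [G] so that
   [|H|^2 + |G|^2] is a constant multiple of [|p|^2 + |q|^2]; hence
   [psi = log (|H|^2 + |G|^2) - k log (1 + |z|^2)] is bounded independently
   of [k].  For [phi = log |H|^2 - k log (1 + |z|^2)], Green's formula gives
   [4 pi sum f(x_i) - k int f dA = int phi Lap f], so it suffices to bound
   [int |phi| dA]; as [phi] is bounded above, only [int (- phi) dA] matters.
   Write [Lap psi = S - k] with [S dA] the pull-back of the area form by [H/G],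
   of total mass [4 pi k].  Green's formula for [phi] and [psi] gives
   [k int (- phi) dA <= int (- phi) S dA + O(k)].  With
   [tau = |H|^2 / (|H|^2 + |G|^2)] one has [phi = psi + log tau],
   [|grad tau|^2 = tau (1 - tau) S] and [Lap tau = (1 - 2 tau) S], so
   integrating the Laplacian of [tau - tau log tau] yields
   [int (- log tau) S <= 3 int S = 12 pi k].
   The logarithmic poles are avoided by replacing [|z - a|^2] with
   [|z - a|^2 + eps (1 + |z|^2)] and letting [eps] tend to [0]. *)

(** * Derivatives and integrals on the plane *)

(** The obstacle is uniformity in [k]. The available bounds on the gradient of [psi] and on the
    density [S] have constants that depend on the polynomials, whereas the final constant may depend
    on [eta] and [B] only. Two kinds of estimates are therefore kept apart. Bounds with uncontrolled
    constants serve only to justify integration and to discard the flux at infinity in Green's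
    formula. The quantitative part uses [ln eta <= psi <= ln B], the total mass of [S], and signs:
    adding a constant to one factor is free, because a Laplacian has integral zero, and makes that
    factor of constant sign. The entropy is forced by the geometry. [H/G] is conformal and [tau] is
    the pull-back of a function on the target sphere, so [s(tau)] has Laplacian [S] times
    [tau (1 - tau) s'' + (1 - 2 tau) s']. To produce [- log tau] near [tau = 0] one takes
    [s' = - log tau], that is [s = tau - tau log tau]. *)

Section Der.
Variable R : realType.
Implicit Types (f g : R -> R) (x a b : R).

Lemma derC (c x : R) : is_derive x 1 (fun=> c) 0.
Proof. exact: is_derive_cst. Qed.

Lemma derI x : is_derive x 1 (fun t : R => t) 1.
Proof. exact: is_derive_id. Qed.

Lemma derD f g x a b : is_derive x 1 f a -> is_derive x 1 g b ->
  is_derive x 1 (fun t => f t + g t) (a + b).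
Proof. exact: is_deriveD. Qed.

Lemma derN f x a : is_derive x 1 f a -> is_derive x 1 (fun t => - f t) (- a).
Proof. exact: is_deriveN. Qed.

Lemma derM f g x a b : is_derive x 1 f a -> is_derive x 1 g b ->
  is_derive x 1 (fun t => f t * g t) (f x * b + g x * a).
Proof. exact: is_deriveM. Qed.

Lemma derX f n x a : is_derive x 1 f a ->
  is_derive x 1 (fun t => f t ^+ n) (n%:R * f x ^+ n.-1 * a).
Proof.
have -> : (fun t => f t ^+ n) = f ^+ n by apply/funext => t; rewrite exprfctE.
exact: is_deriveX.
Qed.

Lemma derV f x a : f x != 0 -> is_derive x 1 f a ->
  is_derive x 1 (fun t => (f t)^-1) (- (f x) ^- 2 * a).
Proof. exact: is_deriveV. Qed.

Lemma der_comp f g x a b : is_derive (g x) 1 f a -> is_derive x 1 g b ->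
  is_derive x 1 (fun t => f (g t)) (a * b).
Proof. exact: is_derive1_comp. Qed.

Lemma der_continuous f x a : is_derive x 1 f a -> {for x, continuous f}.
Proof.
move=> df; apply: differentiable_continuous.
exact/derivable1_diffP/(@ex_derive _ _ _ _ _ _ _ df).
Qed.

Lemma ders_continuous f : (forall x : R, exists a, is_derive x 1 f a) ->
  continuous f.
Proof. by move=> df x; have [a] := df x; exact: der_continuous. Qed.

End Der.

(** Meant for goals whose derivative is an existential variable, synthesised by the rules and
    compared afterwards by [ring] or [field]. [notypeclasses refine] keeps instance search away from
    the premises; derivatives of unknown functions and the side conditions of inverse, logarithm and
    root are left as goals. *)
Ltac der := lazymatch goal with
  | |- is_derive _ _ (fun _ => ?c) _ => notypeclasses refine (@derC _ c _)
  | |- is_derive _ _ (fun t => t) _ => notypeclasses refine (@derI _ _)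
  | |- is_derive _ _ (fun t => @?f t + @?g t) _ =>
      notypeclasses refine (@derD _ f g _ _ _ _ _); der
  | |- is_derive _ _ (fun t => - @?f t) _ =>
      notypeclasses refine (@derN _ f _ _ _); der
  | |- is_derive _ _ (fun t => @?f t * @?g t) _ =>
      notypeclasses refine (@derM _ f g _ _ _ _ _); der
  | |- is_derive _ _ (fun t => @?f t ^+ ?n) _ =>
      notypeclasses refine (@derX _ f n _ _ _); der
  | |- is_derive _ _ (fun t => (@?f t)^-1) _ =>
      notypeclasses refine (@derV _ f _ _ _ _); [|der]
  | |- is_derive _ _ (fun t => atan (@?f t)) _ =>
      notypeclasses refine (@der_comp _ (@atan _) f _ _ _ (is_derive1_atan _) _); der
  | |- is_derive _ _ (fun t => ln (@?f t)) _ =>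
      notypeclasses refine (@der_comp _ (@ln _) f _ _ _ (is_derive1_ln _) _); [|der]
  | |- is_derive _ _ (fun t => Num.sqrt (@?f t)) _ =>
      notypeclasses refine (@der_comp _ (@Num.sqrt _) f _ _ _ (is_derive1_sqrt _) _); [|der]
  | |- _ => idtac
  end.

Section PlaneIntegral.
Variable R : realType.
Implicit Types (f g h : R -> R -> R).

Notation R2 := (measurableTypeR R * measurableTypeR R)%type.

(** Second countability: an open set is the union of the countably many rational boxes it contains.
    This links the product topology with the product sigma-algebra. *)
Lemma open_measurable_plane (U : set (R * R)) : open U -> measurable (U : set R2).
Proof.
move=> oU.
pose box (q : rat * rat * rat * rat) : set R2 :=
  `]ratr q.1.1.1 : R, ratr q.1.1.2[ `*` `]ratr q.1.2, ratr q.2[.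
have -> : U = \bigcup_(q in [set q | box q `<=` U]) box q.
  apply/seteqP; split => [[x y] Uxy|z [q /= qU]]; last exact: qU.
  have /nbhs_ballP [e /= e0 eU] : nbhs (x, y) U by exact: open_nbhs_nbhs.
  have rat_lt (u v : R) : u < v -> exists a : rat, u < ratr a < v.
    by move=> /rat_in_itvoo[a]; rewrite in_itv; exists a.
  have [a /andP[ax xa]] : exists a : rat, x - e < ratr a < x by apply: rat_lt; lra.
  have [b /andP[bx xb]] : exists a : rat, x < ratr a < x + e by apply: rat_lt; lra.
  have [c /andP[cy yc]] : exists a : rat, y - e < ratr a < y by apply: rat_lt; lra.
  have [d /andP[dy yd]] : exists a : rat, y < ratr a < y + e by apply: rat_lt; lra.
  exists (a, b, c, d); last by rewrite /box/=; split; rewrite /= in_itv/=; apply/andP.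
  move=> [u v] [/=]; rewrite !in_itv/= => /andP[au ub] /andP[cv vd].
  apply: eU; split; rewrite /ball/= ltr_norml; apply/andP; split; lra.
rewrite bigcup_mkcond; apply: countable_bigcupT_measurable; first exact: countableP.
move=> q; case: ifPn => _ //.
by apply: measurableX; exact: measurable_itv.
Qed.

Lemma jcont_measurable h : jcont h ->
  measurable_fun [set: R2] (fun p : R2 => h p.1 p.2).
Proof.
move=> ch; apply: (measurability _ (RGenOpens.measurableE R)).
move=> _ [_ [a [b ->] <-]]; rewrite setTI; apply: open_measurable_plane.
have /continuousP := (ch : continuous (fun q : R * R => h q.1 q.2)).
by apply; exact: interval_open.
Qed.

End PlaneIntegral.

(** * Total area of the round metric in the affine chart *)

Section SphereArea.
Variable R : realType.

Lemma integralT_even_FTC (f F : R -> R) (l r : R) :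
  (forall x, 0 <= f x) -> continuous f -> f =1 f \o -%R ->
  (forall x : R, is_derive x 1 F (f x)) -> F x @[x --> +oo] --> l ->
  r = 2 * (l - F 0) ->
  (\int[lebesgue_measure]_x (f x)%:E = r%:E)%E.
Proof.
move=> f0 cf evf dF Fl ->; rewrite ge0_symfun_integralT// -set_itvcy.
rewrite (@ge0_continuous_FTC2y R f F 0 l) //.
- exact: continuous_subspaceT.
- by apply: cvg_at_right_filter; apply: der_continuous; exact: dF.
- by move=> x _; rewrite derive1E; apply: derive_val; exact: dF.
Qed.

Definition sdens (x y : R) : R := 4 / (1 + x ^+ 2 + y ^+ 2) ^+ 2.

Lemma cvg_invy : (x : R)^-1 @[x --> +oo] --> (0 : R).
Proof. by apply/gtr0_cvgV0; [exact: nbhs_pinfty_gt|exact: cvg_id]. Qed.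

Lemma integral_sdens_y (x : R) : (\int[lebesgue_measure]_y (sdens x y)%:E =
  (2 * pi / ((1 + x ^+ 2) * Num.sqrt (1 + x ^+ 2)))%:E)%E.
Proof.
set A := 1 + x ^+ 2; set r := Num.sqrt A.
have A0 : 0 < A by rewrite /A; nra.
have r0 : 0 < r by rewrite sqrtr_gt0.
have rA : r ^+ 2 = A by rewrite sqr_sqrtr// ltW.
(* Antiderivative of [4 / (A + y^2)^2] vanishing at [0]; at infinity only the [atan] term survives,
   with limit [pi / (A * r)]. *)
pose F y : R := 2 / A * (y / (A + y ^+ 2)) + 2 / (A * r) * atan (y / r).
have Ay y : 0 < A + y ^+ 2 by nra.
apply: (@integralT_even_FTC (sdens x) F (pi / (A * r))).
- by move=> y; rewrite /sdens divr_ge0// sqr_ge0.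
- apply: ders_continuous => y; eexists; rewrite /sdens; der.
  by rewrite expf_eq0/= gt_eqF// Ay.
- by move=> y; rewrite /sdens/= sqrrN.
- move=> y; rewrite /F; eapply is_derive_eq.
    by der; rewrite ?gt_eqF// ?Ay//.
  rewrite /sdens -/A /=.
  have := Ay y; rewrite -rA => /gt_eqF/negbT yn.
  field; rewrite yn !gt_eqF//=; nra.
- have -> : pi / (A * r) = 2 / A * 0 + 2 / (A * r) * (pi / 2).
    by field; rewrite !gt_eqF.
  apply: cvgD; apply: cvgM; try exact: cvg_cst.
    apply: (@squeeze_cvgr _ _ _ _ (cst 0) (fun x => x^-1)).
    + near=> t; have t0 : 0 < t by near: t; exact: nbhs_pinfty_gt.
      apply/andP; split; first by rewrite divr_ge0 ?ltW.
      by rewrite ler_pdivrMr// mulrC ler_pdivlMr//; nra.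
    + exact: cvg_cst.
    + exact: cvg_invy.
  apply: (cvg_comp _ _ _ (@cvgy_atan R)).
  by apply: gt0_cvgMly; [rewrite invr_gt0|exact: cvg_id].
- by rewrite /F mul0r mul0r atan0 !mulr0 addr0 subr0 mulrA.
Unshelve. all: by end_near. Qed.

Lemma integral_sdens_x :
  (\int[lebesgue_measure]_x (2 * pi / ((1 + x ^+ 2) * Num.sqrt (1 + x ^+ 2)))%:E =
  (4 * pi : R)%:E)%E.
Proof.
have A0 (x : R) : 0 < 1 + x ^+ 2 by nra.
have r0 (x : R) : 0 < Num.sqrt (1 + x ^+ 2) by rewrite sqrtr_gt0.
(* The derivative of [x / sqrt (1 + x^2)] is [(1 + x^2)^(-3/2)]. *)
pose F (x : R) : R := 2 * pi * (x / Num.sqrt (1 + x ^+ 2)).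
pose f (x : R) : R := 2 * pi / ((1 + x ^+ 2) * Num.sqrt (1 + x ^+ 2)).
apply: (@integralT_even_FTC f F (2 * pi)).
- by move=> x; rewrite divr_ge0 ?mulr_ge0 ?pi_ge0// ltW.
- apply: ders_continuous => x; eexists; rewrite /f; der; first by rewrite gt_eqF// mulr_gt0.
  exact: A0.
- by move=> x; rewrite /f /= sqrrN.
- move=> x; rewrite /F; eapply is_derive_eq.
    by der; rewrite ?gt_eqF// ?r0// ?A0//.
  rewrite /f /=; have := r0 x; have := A0 x.
  have : Num.sqrt (1 + x ^+ 2) ^+ 2 = 1 + x ^+ 2 by rewrite sqr_sqrtr// ltW.
  set r := Num.sqrt _ => /[dup] rE <- r2 rp.
  transitivity (2 * pi * (r ^+ 2 - x ^+ 2) / r ^+ 3).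
    by field; rewrite gt_eqF.
  have -> : r ^+ 2 - x ^+ 2 = 1 by rewrite rE; ring.
  by rewrite mulr1; congr (_ / _); ring.
- rewrite -[X in _ --> X]mulr1; apply: cvgM; first exact: cvg_cst.
  apply: (@squeeze_cvgr _ _ _ _ (fun x => 1 - x^-1) (cst 1)).
  + near=> t; have t0 : 0 < t by near: t; exact: nbhs_pinfty_gt.
    have : Num.sqrt (1 + t ^+ 2) ^+ 2 = 1 + t ^+ 2 by rewrite sqr_sqrtr// ltW.
    have := r0 t; set r := Num.sqrt _ => rp rE.
    have rt : t <= r by nra.
    rewrite /= ler_pdivrMr// mul1r rt andbT ler_pdivlMr//.
    rewrite -(ler_pM2l t0) mulrA mulrBr mulr1 divff ?gt_eqF//; nra.
  + rewrite -[X in _ --> X]subr0; apply: cvgB; first exact: cvg_cst.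
    exact: cvg_invy.
  + exact: cvg_cst.
- by rewrite /F mul0r mulr0 subr0 mulrA -natrM.
Unshelve. all: by end_near. Qed.

End SphereArea.

Section JointContinuity.
Variable R : realType.
Implicit Types (f g h : R -> R -> R) (u : R -> R).

Lemma jcontC (c : R) : jcont (fun _ _ : R => c).
Proof. by move=> p; exact: cvg_cst. Qed.

Lemma jcontx : jcont (fun x _ : R => x).
Proof. by move=> p; exact: cvg_fst. Qed.

Lemma jconty : jcont (fun _ y : R => y).
Proof. by move=> p; exact: cvg_snd. Qed.

Lemma jcontD f g : jcont f -> jcont g -> jcont (fun x y => f x y + g x y).
Proof. by move=> cf cg p; apply: cvgD; [exact: cf|exact: cg]. Qed.

Lemma jcontN f : jcont f -> jcont (fun x y => - f x y).
Proof. by move=> cf p; apply: cvgN; exact: cf. Qed.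

Lemma jcontM f g : jcont f -> jcont g -> jcont (fun x y => f x y * g x y).
Proof. by move=> cf cg p; apply: cvgM; [exact: cf|exact: cg]. Qed.

Lemma jcontX f n : jcont f -> jcont (fun x y => f x y ^+ n).
Proof.
move=> cf; elim: n => [|n IH]; first exact: jcontC.
by under eq_fun do under eq_fun do rewrite exprS; exact: (jcontM cf IH).
Qed.

Lemma jcontV f : (forall x y, f x y != 0) -> jcont f -> jcont (fun x y => (f x y)^-1).
Proof. by move=> f0 cf p; apply: cvgV; [exact: f0|exact: cf]. Qed.

Lemma jcont_comp u f : (forall x y, {for f x y, continuous u}) -> jcont f ->
  jcont (fun x y => u (f x y)).
Proof.
move=> cu cf p.
apply: (@continuous_comp _ _ _ (fun q : R * R => f q.1 q.2) u p); first exact: cf.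
exact: cu.
Qed.

Lemma jcont_ln f : (forall x y, 0 < f x y) -> jcont f ->
  jcont (fun x y => ln (f x y)).
Proof.
by move=> f0; apply: (@jcont_comp (@ln R) f) => x y; apply: continuous_ln; exact: f0.
Qed.

End JointContinuity.

Ltac jc := lazymatch goal with
  | |- jcont (fun _ _ => ?c) => exact: jcontC
  | |- jcont (fun x _ => x) => exact: jcontx
  | |- jcont (fun _ y => y) => exact: jconty
  | |- jcont (fun x y => @?f x y + @?g x y) => apply: (@jcontD _ f g); jc
  | |- jcont (fun x y => - @?f x y) => apply: (@jcontN _ f); jc
  | |- jcont (fun x y => @?f x y * @?g x y) => apply: (@jcontM _ f g); jc
  | |- jcont (fun x y => @?f x y ^+ ?n) => apply: (@jcontX _ f n); jc
  | |- jcont (fun x y => (@?f x y)^-1) => apply: (@jcontV _ f); [|jc]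
  | |- jcont (fun x y => ln (@?f x y)) => apply: (@jcont_ln _ f); [|jc]
  | |- _ => try assumption
  end.

Section PlaneIntegral.
Variable R : realType.
Implicit Types (f g h : R -> R -> R).

Notation leb := (@lebesgue_measure R).
Notation leb2 := (leb \x leb)%E.
Notation sdens := (@sdens R).

Lemma onesq_gt0 (x y : R) : 0 < 1 + x ^+ 2 + y ^+ 2.
Proof. by nra. Qed.

Lemma sdens_gt0 (x y : R) : 0 < sdens x y.
Proof. by rewrite /sdens divr_gt0// exprn_gt0// onesq_gt0. Qed.

Lemma jcont_sdens : jcont sdens.
Proof.
rewrite /sdens; jc => x y; by rewrite expf_neq0// gt_eqF// onesq_gt0.
Qed.

Lemma integral_sdens :
  (\int[leb2]_p (sdens p.1 p.2)%:E = (4 * pi : R)%:E)%E.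
Proof.
rewrite fubini_tonelli1/=.
- rewrite -integral_sdens_x; apply: eq_integral => x _.
  by rewrite -integral_sdens_y.
- by apply/measurable_EFinP; exact: jcont_measurable jcont_sdens.
- by move=> p; rewrite lee_fin ltW// sdens_gt0.
Qed.

(** Equivalently, [g dx dy] has a bounded continuous density with respect to the round area, whose
    total mass is finite. Integrability on the plane is always derived from this domination. *)
Definition tdom g := jcont g /\ exists C, forall x y, `|g x y| <= C * sdens x y.

Definition pint g : R := (\int[leb2]_p g p.1 p.2)%R.

Lemma pint_sdens : pint sdens = 4 * pi.
Proof. by rewrite /pint /Rintegral integral_sdens. Qed.

Lemma integrable_sdens C :
  leb2.-integrable setT (fun p => (C * sdens p.1 p.2)%:E).
Proof.
apply/integrableP; split.
  by apply/measurable_EFinP; exact: jcont_measurable (jcontM (@jcontC R C) (@jcont_sdens)).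
under eq_integral do rewrite abse_EFin normrM EFinM (gtr0_norm (sdens_gt0 _ _)).
rewrite ge0_integralZl//.
- by rewrite integral_sdens -EFinM ltry.
- by apply/measurable_EFinP; exact: jcont_measurable jcont_sdens.
- by move=> p _; rewrite lee_fin ltW// sdens_gt0.
Qed.

Lemma tdom_integrable g : tdom g ->
  leb2.-integrable setT (fun p => (g p.1 p.2)%:E).
Proof.
move=> [cg [C gC]]; apply: le_integrable (integrable_sdens C) => //.
- by apply/measurable_EFinP; exact: jcont_measurable.
- move=> p _; rewrite !abse_EFin lee_fin.
  by rewrite (le_trans (gC _ _))// ler_norm.
Qed.

Lemma tdomD f g : tdom f -> tdom g -> tdom (fun x y => f x y + g x y).
Proof.
move=> [cf [C fC]] [cg [D gD]]; split; first exact: jcontD.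
by exists (C + D) => x y; rewrite mulrDl (le_trans (ler_normD _ _))// lerD.
Qed.

Lemma tdomZ c f : tdom f -> tdom (fun x y => c * f x y).
Proof.
move=> [cf [C fC]]; split; first exact: (jcontM (@jcontC R c) cf).
by exists (`|c| * C) => x y; rewrite normrM -mulrA ler_wpM2l.
Qed.

Lemma tdomM f g C : jcont f -> (forall x y, `|f x y| <= C) -> tdom g ->
  tdom (fun x y => f x y * g x y).
Proof.
move=> cf fC [cg [D gD]]; split; first exact: jcontM.
by exists (C * D) => x y; rewrite normrM -mulrA ler_pM.
Qed.

Lemma tdom_sdens : tdom sdens.
Proof.
split; first exact: jcont_sdens.
by exists 1 => x y; rewrite mul1r gtr0_norm// sdens_gt0.
Qed.

Lemma tdom_sum (I : Type) (s : seq I) (F : I -> R -> R -> R) :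
  (forall i, tdom (F i)) -> tdom (fun x y => \sum_(i <- s) F i x y).
Proof.
move=> tF; elim: s => [|i s IH].
  under eq_fun do under eq_fun do rewrite big_nil.
  by split; [exact: jcontC|exists 0 => x y; rewrite normr0 mul0r].
by under eq_fun do under eq_fun do rewrite big_cons; exact: (tdomD (tF i) IH).
Qed.

Lemma pintD f g : tdom f -> tdom g ->
  pint (fun x y => f x y + g x y) = pint f + pint g.
Proof. by move=> tf tg; rewrite /pint RintegralD//; exact: tdom_integrable. Qed.

Lemma pintZ c f : tdom f -> pint (fun x y => c * f x y) = c * pint f.
Proof. by move=> tf; rewrite /pint RintegralZl//; exact: tdom_integrable. Qed.

Lemma le_pint f g : tdom f -> tdom g -> (forall x y, f x y <= g x y) ->
  pint f <= pint g.
Proof. by move=> tf tg fg; apply: le_Rintegral => //; exact: tdom_integrable. Qed.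

Lemma pint_sum (I : Type) (s : seq I) (F : I -> R -> R -> R) :
  (forall i, tdom (F i)) ->
  pint (fun x y => \sum_(i <- s) F i x y) = \sum_(i <- s) pint (F i).
Proof.
move=> tF; elim: s => [|i s IH].
  under eq_fun do under eq_fun do rewrite big_nil.
  by rewrite big_nil /pint /Rintegral integral0.
under eq_fun do under eq_fun do rewrite big_cons.
by rewrite big_cons pintD ?IH//; exact: tdom_sum.
Qed.

Lemma pint_norm f g : tdom f -> tdom g -> (forall x y, `|f x y| <= g x y) ->
  `|pint f| <= pint g.
Proof.
move=> tf tg fg; rewrite ler_norml -mulN1r -pintZ// !le_pint//.
- by move=> x y; have := fg x y; rewrite ler_norml => /andP[].
- exact: tdomZ.
- by move=> x y; have := fg x y; rewrite ler_norml mulN1r => /andP[].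
Qed.

End PlaneIntegral.

Section Box.
Variable R : realType.
Implicit Types (f g h : R -> R -> R).

Lemma jcont_sectx h y : jcont h -> continuous (h ^~ y).
Proof.
move=> ch x.
apply: (@continuous_comp _ _ _ (fun t : R => (t, y)) (fun q => h q.1 q.2) x).
  exact: (@cvg_pair _ _ _ (nbhs x) (nbhs x) (nbhs y) _ _ _ id (cst y) cvg_id (cvg_cst _)).
exact: ch.
Qed.

Lemma jcont_secty h x : jcont h -> continuous (h x).
Proof.
move=> ch y.
apply: (@continuous_comp _ _ _ (fun t : R => (x, t)) (fun q => h q.1 q.2) y).
  exact: (@cvg_pair _ _ _ (nbhs y) (nbhs x) (nbhs y) _ _ _ (cst x) id (cvg_cst _) cvg_id).
exact: ch.
Qed.

Lemma jcont_box_bounded h a : jcont h ->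
  exists C, forall x y, `|x| <= a -> `|y| <= a -> `|h x y| <= C.
Proof.
move=> ch.
have cK : compact (`[- a, a] `*` `[- a, a] : set (R * R)).
  by apply: compact_setX; exact: segment_compact.
have : {within `[- a, a] `*` `[- a, a], continuous (fun q : R * R => h q.1 q.2)}.
  exact: continuous_subspaceT.
move=> /continuous_compact/(_ cK)/compact_bounded[M [_ hM]].
exists (M + 1) => x y xa ya; apply: (hM (M + 1)); first by rewrite ltrDl.
by exists (x, y) => //=; split; rewrite /= in_itv/= -ler_norml.
Qed.

End Box.

(** * Divergence theorem on the plane, with vanishing flux at infinity *)

Section Divergence.
Variable R : realType.
Implicit Types (f g h X : R -> R -> R).
Notation leb := (@lebesgue_measure R).
Notation leb2 := (leb \x leb)%E.
Notation R2 := (measurableTypeR R * measurableTypeR R)%type.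
Notation sdens := (@sdens R).

Let itv a : set (measurableTypeR R) := `[- a, a]%classic.
Let box a : set R2 := itv a `*` itv a.

Let mem_itv a x : itv a x <-> `|x| <= a.
Proof. by rewrite /itv/= in_itv/= ler_norml. Qed.

Let measurable_box a : measurable (box a).
Proof. by apply: measurableX; exact: measurable_itv. Qed.

(** Extension by zero outside the box: integrals over the box become integrals over the whole plane,
    where Fubini applies to the full product measure. *)
Let cut a h (p : R2) : \bar R := ((fun p : R2 => (h p.1 p.2)%:E) \_ (box a)) p.

Let cutE a h x y :
  cut a h (x, y) = if (`|x| <= a) && (`|y| <= a) then (h x y)%:E else 0%E.
Proof.
rewrite /cut patchE; case: ifPn => [/set_mem[/mem_itv/= -> /mem_itv/= -> //]|].
rewrite notin_setE => bxy; case: ifPn => // /andP[xa ya].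
by exfalso; apply: bxy; split; apply/mem_itv.
Qed.

Let integrable_cut a h : jcont h -> leb2.-integrable setT (cut a h).
Proof.
move=> ch; have [C hC] := jcont_box_bounded a ch.
(* [d] is the value of [sdens] at the corners, its minimum on the box. *)
pose d := 4 / (1 + a ^+ 2 + a ^+ 2) ^+ 2.
have d0 : 0 < d by rewrite divr_gt0// exprn_gt0// onesq_gt0.
apply: le_integrable (integrable_sdens (`|C| / d)) => //.
  have mh : measurable_fun (box a) (fun p : R2 => (h p.1 p.2)%:E).
    apply: measurable_funTS; apply/measurable_EFinP; exact: jcont_measurable.
  exact: (measurable_restrictT _ (measurable_box a)).1 mh.
move=> [x y] _; rewrite cutE [leRHS]abse_EFin normrM.
have s0 := sdens_gt0 x y.
case: ifPn => [/andP[xa ya]|_]; last by rewrite abse0 lee_fin mulr_ge0.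
rewrite abse_EFin lee_fin (le_trans (hC x y xa ya))// (le_trans (ler_norm C))//.
rewrite normf_div normr_id (gtr0_norm d0) (gtr0_norm s0) -mulrA ler_peMr// mulrC ler_pdivlMr// mul1r.
rewrite /d /sdens ler_pM2l// lef_pV2 ?posrE ?exprn_gt0 ?onesq_gt0//.
have xa2 : x ^+ 2 <= a ^+ 2.
  by rewrite -(real_normK (num_real x)) lerXn2r// nnegrE (le_trans _ xa).
have ya2 : y ^+ 2 <= a ^+ 2.
  by rewrite -(real_normK (num_real y)) lerXn2r// nnegrE (le_trans _ xa).
by rewrite lerXn2r ?nnegrE; nra.
Qed.

Let cvg_cut g : tdom g ->
  (fun n => fine (\int[leb2]_p cut n%:R g p)%E) @ \oo --> pint g.
Proof.
move=> tg; have [cg [C gC]] := tg.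
have [] // := @dominated_convergence _ _ _ leb2 setT measurableT
  (fun n p => cut n%:R g p) (fun p => (g p.1 p.2)%:E) (fun p => (C * sdens p.1 p.2)%:E).
- by move=> n; have /integrableP[] := @integrable_cut n%:R g cg.
- by apply/measurable_EFinP; exact: jcont_measurable.
- apply: aeW => -[x y] _; apply: cvg_near_cst; near=> n.
  rewrite cutE ifT//; apply/andP; split; near: n; exact: nbhs_infty_ger.
- exact: integrable_sdens.
- apply: aeW => -[x y] n _; rewrite cutE; case: ifPn => _.
    by rewrite abse_EFin lee_fin.
  by rewrite abse0 lee_fin (le_trans _ (gC x y)).
move=> _ _ cv; rewrite /pint /Rintegral; apply: fine_cvg.
rewrite fineK//; apply: integrable_fin_num => //; exact: tdom_integrable.
Unshelve. all: by end_near. Qed.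

Let int_itv_le (a B : R) (G : R -> \bar R) : 0 <= a -> 0 <= B ->
  measurable_fun [set: measurableTypeR R] G ->
  (forall y, (`|G y| <= (if `|y| <= a then B else 0)%:E)%E) ->
  (`|\int[leb]_y G y| <= (2 * a * B)%:E)%E.
Proof.
move=> a0 B0 mG GB; apply: (le_trans (le_abse_integral _ _ _)) => //.
have -> : ((2 * a * B)%:E = \int[leb]_y (B%:E * (\1_(itv a) y)%:E))%E.
  have mI : measurable (itv a) by exact: measurable_itv.
  have -> : (\int[leb]_y (B%:E * (\1_(itv a) y)%:E) = B%:E * leb (itv a))%E.
    transitivity (B%:E * \int[leb]_y (\1_(itv a) y)%:E)%E; last first.
      by rewrite integral_indic// setIT.
    apply: ge0_integralZl => //; first by apply/measurable_EFinP; exact: measurable_indic.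
  have -> : leb (itv a) = if (- a < a)%R then (a - - a)%:E else 0%E.
    by rewrite EFinB -lte_fin; exact: (lebesgue_measure_itv `[- a, a]%R).
  case: ifPn => [_|]; first by rewrite -EFinM; congr EFin; ring.
  rewrite -leNgt => a0'; have -> : a = 0 by lra.
  by rewrite mule0 mulr0 mul0r.
have mI : measurable_fun [set: measurableTypeR R] (fun y => (B%:E * (\1_(itv a) y)%:E)%E).
  apply: measurable_funeM; apply/measurable_EFinP; apply: measurable_indic.
  exact: measurable_itv.
apply: ge0_le_integral => //; first exact: measurableT_comp.
move=> y _; apply: (le_trans (GB y)); rewrite indicE.
case: ifPn => [/mem_itv ya|]; first by rewrite mem_set// mule1.
by rewrite mule_ge0 // lee_fin.
Qed.

Let FTC_itv a (F f : R -> R) : 0 < a -> (forall x : R, is_derive x 1 F (f x)) ->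
  continuous f ->
  (\int[leb]_(x in itv a) (f x)%:E = (F a - F (- a))%:E)%E.
Proof.
move=> a0 dF cf; rewrite /itv (@continuous_FTC2 _ f F) ?EFinB//.
- by lra.
- exact: continuous_subspaceT.
- split.
  + by move=> x _; exact: ex_derive.
  + by apply: cvg_at_right_filter; exact: der_continuous (dF _).
  + by apply: cvg_at_left_filter; exact: der_continuous (dF _).
- by move=> x _; rewrite derive1E; apply: derive_val; exact: dF.
Qed.

Let cut_divx a B X DX : 0 < a -> 0 <= B ->
  (forall x y : R, is_derive x 1 (X ^~ y) (DX x y)) -> jcont DX ->
  (forall y, `|y| <= a -> `|X a y - X (- a) y| <= B) ->
  (`|\int[leb2]_p cut a DX p| <= (2 * a * B)%:E)%E.
Proof.
move=> a0 B0 dX cD XB; have iD := integrable_cut a cD.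
rewrite -integral21_prod_meas1//; apply: int_itv_le => //; first exact: ltW.
  exact: (measurable_fubini_G iD).
move=> y; rewrite /fubini_G; case: ifPn => ya; last first.
  rewrite integral0_eq ?abse0// => x _.
  by rewrite cutE (negbTE ya) andbF.
rewrite (_ : (\int[leb]_x cut a DX (x, y))%E = (X a y - X (- a) y)%:E).
  by rewrite abse_EFin lee_fin XB.
rewrite -(FTC_itv a0 (fun x => dX x y)); last exact: jcont_sectx.
rewrite [RHS]integral_mkcond; apply: eq_integral => x _.
rewrite cutE ya andbT patchE; case: ifPn => xa.
  by rewrite mem_set//; exact/mem_itv.
by rewrite memNset// => /mem_itv; apply/negP.
Qed.

Let cut_divy a B X DX : 0 < a -> 0 <= B ->
  (forall x y : R, is_derive y 1 (X x) (DX x y)) -> jcont DX ->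
  (forall x, `|x| <= a -> `|X x a - X x (- a)| <= B) ->
  (`|\int[leb2]_p cut a DX p| <= (2 * a * B)%:E)%E.
Proof.
move=> a0 B0 dX cD XB; have iD := integrable_cut a cD.
rewrite -integral12_prod_meas1//; apply: int_itv_le => //; first exact: ltW.
  exact: (measurable_fubini_F iD).
move=> x; rewrite /fubini_F; case: ifPn => xa; last first.
  rewrite integral0_eq ?abse0// => y _.
  by rewrite cutE (negbTE xa).
rewrite (_ : (\int[leb]_y cut a DX (x, y))%E = (X x a - X x (- a))%:E).
  by rewrite abse_EFin lee_fin XB.
rewrite -(FTC_itv a0 (fun y => dX x y)); last exact: jcont_secty.
rewrite [RHS]integral_mkcond; apply: eq_integral => y _.
rewrite cutE xa patchE/=; case: ifPn => ya.
  by rewrite mem_set//; exact/mem_itv.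
by rewrite memNset// => /mem_itv; apply/negP.
Qed.

(** The flux through the boundary of [[-a, a]^2] is a length of order [a] times a field of order
    [1 / a^2]. Only the sum [DX + DY] is assumed integrable on the plane, so the two terms are
    separated on a box, where Fubini and the fundamental theorem treat each of them, before [a]
    tends to infinity. *)
Theorem pint_div0 X DX Y DY C :
  (forall x y : R, is_derive x 1 (X ^~ y) (DX x y)) -> jcont DX ->
  (forall x y : R, is_derive y 1 (Y x) (DY x y)) -> jcont DY ->
  (forall x y, `|X x y| <= C / (1 + x ^+ 2 + y ^+ 2)) ->
  (forall x y, `|Y x y| <= C / (1 + x ^+ 2 + y ^+ 2)) ->
  tdom (fun x y => DX x y + DY x y) ->
  pint (fun x y => DX x y + DY x y) = 0.
Proof.
move=> dX cX dY cY XC YC tD.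
have C0 : 0 <= C.
  by have := XC 0 0; rewrite expr0n/= !addr0 divr1; exact: le_trans.
have c0 : (fun n => 8 * C * n%:R^-1) @ \oo --> (0 : R).
  rewrite -[X in _ --> X](mulr0 (8 * C)); apply: cvgM; first exact: cvg_cst.
  by apply/gtr0_cvgV0; [exact: nbhs_infty_gtr|exact: cvgr_idn].
have /cvg_unique := cvg_cut tD; apply => //.
apply: (@squeeze_cvgr _ _ _ _ (fun n => - (8 * C * (n%:R)^-1)) (fun n => 8 * C * (n%:R)^-1)).
- near=> n; rewrite -ler_norml.
  have n0 : 0 < n%:R :> R by near: n; exact: nbhs_infty_gtr.
  (* [B] bounds the difference of the field at opposite points of the boundary. Sides have length
     [2 a], so each direction contributes at most [2 a B = 4 C / a], which gives [8 C / n] in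
     total. *)
  pose a : R := n%:R; pose B := 2 * C / a ^+ 2.
  have B0 : 0 <= B by rewrite divr_ge0 ?mulr_ge0// sqr_ge0.
  have bnd (s t x y : R) : `|s| <= C / (1 + x ^+ 2 + y ^+ 2) ->
     `|t| <= C / (1 + x ^+ 2 + y ^+ 2) -> a ^+ 2 <= x ^+ 2 + y ^+ 2 -> `|s - t| <= B.
    move=> sC tC axy; rewrite (le_trans (ler_normB _ _))//.
    have -> : B = C / a ^+ 2 + C / a ^+ 2 by rewrite /B; field; rewrite gt_eqF.
    have q : C / (1 + x ^+ 2 + y ^+ 2) <= C / a ^+ 2.
      apply: ler_wpM2l => //; rewrite lef_pV2 ?posrE ?onesq_gt0 ?exprn_gt0//; lra.
    by rewrite lerD// (le_trans _ q).
  have ix := integrable_cut n%:R cX; have iy := integrable_cut n%:R cY.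
  have cutD p : cut n%:R (fun x y => DX x y + DY x y) p = (cut n%:R DX p + cut n%:R DY p)%E.
    by case: p => x y; rewrite !cutE; case: ifP; rewrite ?EFinD ?adde0.
  under eq_integral do rewrite cutD.
  rewrite integralD// fineD ?integrable_fin_num//.
  have -> : 8 * C * (n%:R)^-1 = 2 * a * B + 2 * a * B.
    by rewrite /B /a; field; rewrite gt_eqF.
  rewrite (le_trans (ler_normD _ _))// lerD//.
    rewrite -lee_fin -fine_abse ?integrable_fin_num// fineK ?fin_num_abs?abse_id; last first.
      by have := integrable_fin_num measurableT ix; rewrite fin_num_abs.
    apply: (@cut_divx a B X) => // y ya; apply: (bnd _ _ a y) => //.
      by have := XC (- a) y; rewrite sqrrN.
    by rewrite lerDl sqr_ge0.
  rewrite -lee_fin -fine_abse ?integrable_fin_num// fineK ?fin_num_abs?abse_id; last first.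
    by have := integrable_fin_num measurableT iy; rewrite fin_num_abs.
  apply: (@cut_divy a B Y) => // x xa; apply: (bnd _ _ x a) => //.
    by have := YC x (- a); rewrite sqrrN.
  by rewrite lerDr sqr_ge0.
- by rewrite -oppr0; apply: cvgN.
- exact: c0.
Unshelve. all: by end_near. Qed.

End Divergence.

(** * Green's formula on the sphere *)

Section Tame.
Variable R : realType.
Implicit Types (f g h L : R -> R -> R).
Notation sdens := (@sdens R).

Definition jet f fx fy fxx fyy : Prop :=
  [/\ forall x y : R, is_derive x 1 (f ^~ y) (fx x y),
      forall x y : R, is_derive y 1 (f x) (fy x y),
      forall x y : R, is_derive x 1 (fx ^~ y) (fxx x y),
      forall x y : R, is_derive y 1 (fy x) (fyy x y) &
      [/\ jcont f, jcont fx, jcont fy, jcont fxx & jcont fyy]].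

(** Chart form of a function on the sphere that is bounded together with its gradient and its
    Laplacian: the round metric rescales the flat gradient by [(1 + |z|^2) / 2] and the flat
    Laplacian by [1 / sdens]. [L] is the flat Laplacian, so integrals against [dx dy] need no area
    factor. *)
Definition tame f L : Prop := exists fx fy fxx fyy C,
  [/\ jet f fx fy fxx fyy,
      forall x y, L x y = fxx x y + fyy x y,
      forall x y, `|f x y| <= C,
      forall x y, `|fx x y| <= C / (1 + x ^+ 2 + y ^+ 2)
               /\ `|fy x y| <= C / (1 + x ^+ 2 + y ^+ 2) &
      forall x y, `|L x y| <= C * sdens x y].

Lemma tame_eq f g L K : f = g -> (forall x y, L x y = K x y) ->
  tame f L -> tame g K.
Proof. by move=> -> LK; have -> : L = K by apply/funext => x; apply/funext. Qed.

Lemma tame_cst c : tame (fun _ _ => c) (fun _ _ => 0).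
Proof.
exists (fun _ _ => 0), (fun _ _ => 0), (fun _ _ => 0), (fun _ _ => 0), `|c|; split.
- by split; [..|by split; exact: jcontC] => x y; exact: derC.
- by move=> x y; rewrite addr0.
- by [].
- by move=> x y; rewrite normr0 divr_ge0// ltW// onesq_gt0.
- by move=> x y; rewrite normr0 mulr_ge0// ltW// sdens_gt0.
Qed.

Lemma tameD f g L K : tame f L -> tame g K ->
  tame (fun x y => f x y + g x y) (fun x y => L x y + K x y).
Proof.
move=> [fx [fy [fxx [fyy [C [[f1 f2 f3 f4 [c0 c1 c2 c3 c4]] fL fC f1C LC]]]]]].
move=> [gx [gy [gxx [gyy [D [[g1 g2 g3 g4 [d0 d1 d2 d3 d4]] gK gD g1D KD]]]]]].
exists (fun x y => fx x y + gx x y), (fun x y => fy x y + gy x y),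
  (fun x y => fxx x y + gxx x y), (fun x y => fyy x y + gyy x y), (C + D); split.
- split; first by move=> x y; apply: derD.
  + by move=> x y; apply: derD.
  + by move=> x y; apply: derD.
  + by move=> x y; apply: derD.
  + by split; apply: jcontD.
- by move=> x y; rewrite fL gK addrACA.
- by move=> x y; rewrite (le_trans (ler_normD _ _))// lerD.
- move=> x y; have [] := f1C x y; have [] := g1D x y => *.
  by split; rewrite (le_trans (ler_normD _ _))// mulrDl lerD.
- by move=> x y; rewrite (le_trans (ler_normD _ _))// mulrDl lerD.
Qed.

Lemma tame_sum (I : Type) (s : seq I) (F K : I -> R -> R -> R) :
  (forall i, tame (F i) (K i)) ->
  tame (fun x y => \sum_(i <- s) F i x y) (fun x y => \sum_(i <- s) K i x y).
Proof.
move=> tF; elim: s => [|i s IH].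
  by apply: tame_eq (tame_cst 0); [apply/funext => x; apply/funext => y|move=> x y];
    rewrite big_nil.
by apply: tame_eq (tameD (tF i) IH); [apply/funext => x; apply/funext => y|move=> x y];
  rewrite big_cons.
Qed.

Lemma tame_jcont f L : tame f L -> jcont f.
Proof. by move=> [fx [fy [fxx [fyy [C [[_ _ _ _ [c0 _ _ _ _]] _ _ _ _]]]]]]. Qed.

Lemma tame_bounded f L : tame f L -> exists C, forall x y, `|f x y| <= C.
Proof. by move=> [fx [fy [fxx [fyy [C [_ _ fC _ _]]]]]]; exists C. Qed.

Lemma tame_tdom f L : tame f L -> tdom L.
Proof.
move=> [fx [fy [fxx [fyy [C [[_ _ _ _ [_ _ _ c3 c4]] fL _ _ LC]]]]]].
split; last by exists C.
have -> : L = fun x y => fxx x y + fyy x y by apply/funext => x; apply/funext.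
exact: jcontD.
Qed.

Lemma tdom_tameM f L g : tame f L -> tdom g -> tdom (fun x y => f x y * g x y).
Proof. by move=> tf tg; have [C fC] := tame_bounded tf; exact: tdomM (tame_jcont tf) fC tg. Qed.

(** The field [f grad g - g grad f] has divergence [f K - g L], and a bounded function times a
    gradient of order [1 / (1 + |z|^2)] has exactly the decay required by [pint_div0]. *)
Lemma green f g L K : tame f L -> tame g K ->
  pint (fun x y => f x y * K x y) = pint (fun x y => g x y * L x y).
Proof.
move=> tf tg.
have tfK := tdom_tameM tf (tame_tdom tg); have tgL := tdom_tameM tg (tame_tdom tf).
apply/eqP; rewrite -subr_eq0 -mulN1r -pintZ// -pintD//; last exact: tdomZ.
have := tdomD tfK (tdomZ (-1) tgL).
move: tf tg => [fx [fy [fxx [fyy [C [[f1 f2 f3 f4 [c0 c1 c2 c3 c4]] fL fC f1C LC]]]]]].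
move=> [gx [gy [gxx [gyy [D [[g1 g2 g3 g4 [d0 d1 d2 d3 d4]] gK gD g1D KD]]]]]].
have -> : (fun x y => f x y * K x y + -1 * (g x y * L x y)) =
  (fun x y => (f x y * gxx x y + - (g x y * fxx x y)) +
     (f x y * gyy x y + - (g x y * fyy x y))).
  by apply/funext => x; apply/funext => y; rewrite fL gK; ring.
move=> tE; apply/eqP.
have bnd x y u v : `|u| <= C / (1 + x ^+ 2 + y ^+ 2) ->
    `|v| <= D / (1 + x ^+ 2 + y ^+ 2) ->
    `|f x y * v - g x y * u| <= (2 * C * D) / (1 + x ^+ 2 + y ^+ 2).
  move=> uC vD; rewrite (le_trans (ler_normB _ _))// !normrM.
  have -> : 2 * C * D / (1 + x ^+ 2 + y ^+ 2) = C * (D / (1 + x ^+ 2 + y ^+ 2)) +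
    D * (C / (1 + x ^+ 2 + y ^+ 2)) by ring.
  by rewrite lerD// ler_pM.
apply: (@pint_div0 _ (fun x y => f x y * gx x y - g x y * fx x y) _
                     (fun x y => f x y * gy x y - g x y * fy x y) _ (2 * C * D)) => //.
- move=> x y; eapply is_derive_eq.
    der; [exact: f1|exact: g3|exact: g1|exact: f3].
  by rewrite /=; ring.
- by jc.
- move=> x y; eapply is_derive_eq.
    der; [exact: f2|exact: g4|exact: g2|exact: f4].
  by rewrite /=; ring.
- by jc.
- by move=> x y; apply: bnd; [have [] := f1C x y|have [] := g1D x y].
- by move=> x y; apply: bnd; [have [] := f1C x y|have [] := g1D x y].
Qed.

Lemma pint_lap0 f L : tame f L -> pint L = 0.
Proof.
move=> tf; have := green (tame_cst 1) tf.
under eq_fun do under eq_fun do rewrite mul1r.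
move=> ->; under eq_fun do under eq_fun do rewrite mulr0.
by rewrite /pint /Rintegral integral0.
Qed.

End Tame.

(** * Logarithms of positive quadratic functions *)

Section LogQuadratic.
Variable R : realType.
Implicit Types (f g h L N : R -> R -> R).
Notation sdens := (@sdens R).

Lemma tame_intro f fx fy fxx fyy L C0 C1 C2 :
  jet f fx fy fxx fyy -> (forall x y, L x y = fxx x y + fyy x y) ->
  (forall x y, `|f x y| <= C0) ->
  (forall x y, `|fx x y| <= C1 / (1 + x ^+ 2 + y ^+ 2)) ->
  (forall x y, `|fy x y| <= C1 / (1 + x ^+ 2 + y ^+ 2)) ->
  (forall x y, `|L x y| <= C2 * sdens x y) -> tame f L.
Proof.
move=> jf fL fC0 fxC1 fyC1 LC2.
have s0 := @onesq_gt0 R; have d0 := @sdens_gt0 R.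
have p0 : 0 <= C0 by exact: le_trans (fC0 0 0).
have p1 : 0 <= C1.
  have := fxC1 0 0; rewrite expr0n/= !addr0 divr1; exact: le_trans.
have p2 : 0 <= C2.
  by have := le_trans (normr_ge0 _) (LC2 0 0); rewrite pmulr_lge0.
exists fx, fy, fxx, fyy, (C0 + C1 + C2); split => //.
- by move=> x y; rewrite (le_trans (fC0 _ _))//; lra.
- move=> x y; split; [rewrite (le_trans (fxC1 _ _))//|rewrite (le_trans (fyC1 _ _))//];
  by rewrite ler_pM2r ?invr_gt0//; lra.
- by move=> x y; rewrite (le_trans (LC2 _ _))// ler_pM2r//; lra.
Qed.

Lemma jet_ln N Nx Ny Nxx Nyy : (forall x y, 0 < N x y) -> jet N Nx Ny Nxx Nyy ->
  jet (fun x y => ln (N x y)) (fun x y => Nx x y / N x y) (fun x y => Ny x y / N x y)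
    (fun x y => Nxx x y / N x y - (Nx x y / N x y) ^+ 2)
    (fun x y => Nyy x y / N x y - (Ny x y / N x y) ^+ 2).
Proof.
move=> N0 [n1 n2 n3 n4 [c0 c1 c2 c3 c4]].
have N0' x y : N x y != 0 by rewrite gt_eqF.
split.
- move=> x y; eapply is_derive_eq; first by der; [exact: N0|exact: n1].
  by rewrite mulrC.
- move=> x y; eapply is_derive_eq; first by der; [exact: N0|exact: n2].
  by rewrite mulrC.
- move=> x y; eapply is_derive_eq; first by der; [exact: n3|exact: N0'|exact: n1].
  by rewrite /=; field.
- move=> x y; eapply is_derive_eq; first by der; [exact: n4|exact: N0'|exact: n2].
  by rewrite /=; field.
- by split; jc.
Qed.

Lemma jetB_scale f fx fy fxx fyy g gx gy gxx gyy k :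
  jet f fx fy fxx fyy -> jet g gx gy gxx gyy ->
  jet (fun x y => f x y - k * g x y) (fun x y => fx x y - k * gx x y)
    (fun x y => fy x y - k * gy x y) (fun x y => fxx x y - k * gxx x y)
    (fun x y => fyy x y - k * gyy x y).
Proof.
move=> [f1 f2 f3 f4 [c0 c1 c2 c3 c4]] [g1 g2 g3 g4 [d0 d1 d2 d3 d4]]; split.
- by move=> x y; eapply is_derive_eq; [der; [exact: f1|exact: g1]|rewrite /=; ring].
- by move=> x y; eapply is_derive_eq; [der; [exact: f2|exact: g2]|rewrite /=; ring].
- by move=> x y; eapply is_derive_eq; [der; [exact: f3|exact: g3]|rewrite /=; ring].
- by move=> x y; eapply is_derive_eq; [der; [exact: f4|exact: g4]|rewrite /=; ring].
- by split; jc.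
Qed.

Definition quad (a b c d x y : R) : R := a * (x ^+ 2 + y ^+ 2) + b * x + c * y + d.

Lemma jet_quad a b c d : jet (quad a b c d) (fun x y => 2 * a * x + b)
  (fun x y => 2 * a * y + c) (fun x y => 2 * a) (fun x y => 2 * a).
Proof.
rewrite /quad; split.
- by move=> x y; eapply is_derive_eq; [der|rewrite /=; ring].
- by move=> x y; eapply is_derive_eq; [der|rewrite /=; ring].
- by move=> x y; eapply is_derive_eq; [der|rewrite /=; ring].
- by move=> x y; eapply is_derive_eq; [der|rewrite /=; ring].
- by split; jc.
Qed.

Lemma quad_onesq (x y : R) : quad 1 0 0 1 x y = 1 + x ^+ 2 + y ^+ 2.
Proof. by rewrite /quad; ring. Qed.

Lemma jet_ln_onesq :
  jet (fun x y => ln (1 + x ^+ 2 + y ^+ 2) : R)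
    (fun x y => 2 * x / (1 + x ^+ 2 + y ^+ 2)) (fun x y => 2 * y / (1 + x ^+ 2 + y ^+ 2))
    (fun x y => 2 / (1 + x ^+ 2 + y ^+ 2) - (2 * x / (1 + x ^+ 2 + y ^+ 2)) ^+ 2)
    (fun x y => 2 / (1 + x ^+ 2 + y ^+ 2) - (2 * y / (1 + x ^+ 2 + y ^+ 2)) ^+ 2).
Proof.
have -> : (fun x y => ln (1 + x ^+ 2 + y ^+ 2) : R) = fun x y => ln (quad 1 0 0 1 x y).
  by apply/funext => x; apply/funext => y; rewrite quad_onesq.
have -> : (fun x y : R => 2 * x / (1 + x ^+ 2 + y ^+ 2)) =
   fun x y => (2 * 1 * x + 0) / quad 1 0 0 1 x y.
  by apply/funext => x; apply/funext => y; rewrite quad_onesq mulr1 addr0.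
have -> : (fun x y : R => 2 * y / (1 + x ^+ 2 + y ^+ 2)) =
   fun x y => (2 * 1 * y + 0) / quad 1 0 0 1 x y.
  by apply/funext => x; apply/funext => y; rewrite quad_onesq mulr1 addr0.
have -> : (fun x y : R => 2 / (1 + x ^+ 2 + y ^+ 2) - (2 * x / (1 + x ^+ 2 + y ^+ 2)) ^+ 2) =
   fun x y => 2 * 1 / quad 1 0 0 1 x y - ((2 * 1 * x + 0) / quad 1 0 0 1 x y) ^+ 2.
  by apply/funext => x; apply/funext => y; rewrite quad_onesq mulr1 addr0.
have -> : (fun x y : R => 2 / (1 + x ^+ 2 + y ^+ 2) - (2 * y / (1 + x ^+ 2 + y ^+ 2)) ^+ 2) =
   fun x y => 2 * 1 / quad 1 0 0 1 x y - ((2 * 1 * y + 0) / quad 1 0 0 1 x y) ^+ 2.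
  by apply/funext => x; apply/funext => y; rewrite quad_onesq mulr1 addr0.
apply: jet_ln; last exact: jet_quad.
by move=> x y; rewrite quad_onesq onesq_gt0.
Qed.

Lemma norm_lin4 (a b c d p q r t T : R) : `|p| <= T -> `|q| <= T -> `|r| <= T -> `|t| <= T ->
  `|a * p + b * q + c * r + d * t| <= (`|a| + `|b| + `|c| + `|d|) * T.
Proof.
move=> pT qT rT tT; rewrite !mulrDl.
have M z u : `|u| <= T -> `|z * u| <= `|z| * T by move=> uT; rewrite normrM ler_wpM2l.
apply: le_trans (ler_normD _ _) _; apply: lerD; last exact: M.
apply: le_trans (ler_normD _ _) _; apply: lerD; last exact: M.
by apply: le_trans (ler_normD _ _) _; apply: lerD; exact: M.
Qed.

Lemma norm_lnB (a b m M : R) : 0 < m -> 0 < b -> m * b <= a -> a <= M * b ->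
  `|ln a - ln b| <= `|ln m| + `|ln M|.
Proof.
move=> m0 b0 mba aMb.
have a0 : 0 < a by rewrite (lt_le_trans _ mba)// mulr_gt0.
have M0 : 0 < M by rewrite -(pmulr_lgt0 _ b0) (lt_le_trans a0).
have h1 : ln m + ln b <= ln a by rewrite -lnM ?posrE// ler_ln ?posrE// mulr_gt0.
have h2 : ln a <= ln M + ln b by rewrite -lnM ?posrE// ler_ln ?posrE// mulr_gt0.
have := ler_norm (ln M); have := ler_norm (- ln m); rewrite normrN => *.
have := normr_ge0 (ln M); have := normr_ge0 (ln m) => *.
by rewrite ler_norml; apply/andP; split; lra.
Qed.

(** The Laplacian of [ln q] is the discriminant [4ad - b^2 - c^2] over [q^2]; for [q = 1 + |z|^2]
    this is [sdens]. Subtracting [ln (1 + |z|^2)] removes the logarithmic growth at infinity. *)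
Lemma tame_ln_quad a b c d m : 0 < m ->
  (forall x y, m * (1 + x ^+ 2 + y ^+ 2) <= quad a b c d x y) ->
  tame (fun x y => ln (quad a b c d x y) - ln (1 + x ^+ 2 + y ^+ 2))
    (fun x y => (4 * a * d - b ^+ 2 - c ^+ 2) / quad a b c d x y ^+ 2 - sdens x y).
Proof.
move=> m0 mq; have s0 := @onesq_gt0 R.
have q0 x y : 0 < quad a b c d x y by rewrite (lt_le_trans _ (mq x y))// mulr_gt0.
pose M := `|a| + `|b| + `|c| + `|d|.
have qM x y : quad a b c d x y <= M * (1 + x ^+ 2 + y ^+ 2).
  apply: le_trans (ler_norm _) _; rewrite /quad -[d in X in `|X|]mulr1.
  by apply: norm_lin4; rewrite ler_norml; apply/andP; split; nra.
have grad (x y t : R) : `|t| <= M * (1 + x ^+ 2 + y ^+ 2) ->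
    `|t / (quad a b c d x y * (1 + x ^+ 2 + y ^+ 2))| <= M / m / (1 + x ^+ 2 + y ^+ 2).
  move=> tM; rewrite normrM normfV (gtr0_norm (mulr_gt0 (q0 x y) (s0 x y))).
  rewrite ler_pdivrMr ?mulr_gt0// (le_trans tM)//.
  have -> : M / m / (1 + x ^+ 2 + y ^+ 2) * (quad a b c d x y * (1 + x ^+ 2 + y ^+ 2)) =
     M / m * quad a b c d x y by field; rewrite !gt_eqF.
  by rewrite mulrAC ler_pdivlMr// -mulrA ler_wpM2l ?addr_ge0// mulrC.
have jL := jetB_scale 1 (jet_ln q0 (jet_quad a b c d)) jet_ln_onesq.
have -> : (fun x y => ln (quad a b c d x y) - ln (1 + x ^+ 2 + y ^+ 2)) =
   (fun x y => ln (quad a b c d x y) - 1 * ln (1 + x ^+ 2 + y ^+ 2)).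
  by apply/funext => x; apply/funext => y; rewrite mul1r.
apply: (tame_intro (C0 := `|ln m| + `|ln M|) (C1 := M / m)
  (C2 := `|4 * a * d - b ^+ 2 - c ^+ 2| / (4 * m ^+ 2) + 1) jL).
- move=> x y; rewrite /sdens; have := q0 x y; have := s0 x y.
  by rewrite {1}/quad /quad => *; field; rewrite !gt_eqF.
- by move=> x y; rewrite mul1r; exact: norm_lnB.
- move=> x y.
  (* Over the common denominator the cubic terms cancel, so the numerator is [O(1 + |z|^2)] and the
     quotient has the decay of a tame gradient. *)
  have -> : (2 * a * x + b) / quad a b c d x y - 1 * (2 * x / (1 + x ^+ 2 + y ^+ 2)) =
    (a * (2 * x) + b * (1 + y ^+ 2 - x ^+ 2) + c * (- (2 * x * y)) + d * (- (2 * x))) /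
      (quad a b c d x y * (1 + x ^+ 2 + y ^+ 2)).
    have := q0 x y; have := s0 x y.
    by rewrite {1}/quad /quad => *; field; rewrite !gt_eqF.
  have x1 := sqr_ge0 (x - 1); have x2 := sqr_ge0 (x + 1); have y1 := sqr_ge0 (y - 1).
  have y2 := sqr_ge0 (y + 1); have xy := sqr_ge0 (x - y); have xy' := sqr_ge0 (x + y).
  have x0 := sqr_ge0 x; have y0 := sqr_ge0 y.
  by apply: grad; apply: norm_lin4; rewrite ler_norml; apply/andP; split; lra.
- move=> x y.
  have -> : (2 * a * y + c) / quad a b c d x y - 1 * (2 * y / (1 + x ^+ 2 + y ^+ 2)) =
    (a * (2 * y) + b * (- (2 * x * y)) + c * (1 + x ^+ 2 - y ^+ 2) + d * (- (2 * y))) /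
      (quad a b c d x y * (1 + x ^+ 2 + y ^+ 2)).
    have := q0 x y; have := s0 x y.
    by rewrite {1}/quad /quad => *; field; rewrite !gt_eqF.
  have x1 := sqr_ge0 (x - 1); have x2 := sqr_ge0 (x + 1); have y1 := sqr_ge0 (y - 1).
  have y2 := sqr_ge0 (y + 1); have xy := sqr_ge0 (x - y); have xy' := sqr_ge0 (x + y).
  have x0 := sqr_ge0 x; have y0 := sqr_ge0 y.
  by apply: grad; apply: norm_lin4; rewrite ler_norml; apply/andP; split; lra.
- move=> x y; rewrite [leRHS]mulrDl mul1r (le_trans (ler_normB _ _))// lerD//; last first.
    by rewrite gtr0_norm// sdens_gt0.
  rewrite normrM normfV (gtr0_norm (exprn_gt0 _ (q0 x y))).
  have -> : `|4 * a * d - b ^+ 2 - c ^+ 2| / (4 * m ^+ 2) * sdens x y =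
    `|4 * a * d - b ^+ 2 - c ^+ 2| / (m * (1 + x ^+ 2 + y ^+ 2)) ^+ 2.
    by rewrite /sdens; field; rewrite !gt_eqF.
  apply: ler_wpM2l => //; rewrite lef_pV2 ?posrE ?exprn_gt0 ?mulr_gt0//.
  by rewrite lerXn2r// ?nnegrE; [exact/ltW/mulr_gt0|exact/ltW].
Qed.

End LogQuadratic.

(** * Potentials of polynomials *)

Section Polynomials.
Variable R : realType.
Implicit Types (P Q : {poly R[i]}).

Definition reP P (x y : R) : R := complex.Re P.[Complex x y].
Definition imP P (x y : R) : R := complex.Im P.[Complex x y].

Lemma ReM (z w : R[i]) : complex.Re (z * w) =
  complex.Re z * complex.Re w - complex.Im z * complex.Im w.
Proof. by case: z w => [a b] [c d]. Qed.

Lemma ImM (z w : R[i]) : complex.Im (z * w) =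
  complex.Re z * complex.Im w + complex.Im z * complex.Re w.
Proof. by case: z w => [a b] [c d]. Qed.

Lemma ReD (z w : R[i]) : complex.Re (z + w) = complex.Re z + complex.Re w.
Proof. by case: z w => [a b] [c d]. Qed.

Lemma ImD (z w : R[i]) : complex.Im (z + w) = complex.Im z + complex.Im w.
Proof. by case: z w => [a b] [c d]. Qed.

Lemma reP_MXaddC P c x y :
  reP (P * 'X + c%:P) x y = reP P x y * x - imP P x y * y + complex.Re c.
Proof. by rewrite /reP hornerMXaddC ReD ReM. Qed.

Lemma imP_MXaddC P c x y :
  imP (P * 'X + c%:P) x y = reP P x y * y + imP P x y * x + complex.Im c.
Proof. by rewrite /imP hornerMXaddC ImD ImM. Qed.

Lemma reP0 x y : reP 0 x y = 0. Proof. by rewrite /reP horner0. Qed.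
Lemma imP0 x y : imP 0 x y = 0. Proof. by rewrite /imP horner0. Qed.

Lemma rePD P Q x y : reP (P + Q) x y = reP P x y + reP Q x y.
Proof. by rewrite /reP hornerD ReD. Qed.
Lemma imPD P Q x y : imP (P + Q) x y = imP P x y + imP Q x y.
Proof. by rewrite /imP hornerD ImD. Qed.

Lemma reP_MX P x y : reP (P * 'X) x y = reP P x y * x - imP P x y * y.
Proof. by rewrite /reP hornerMX ReM. Qed.
Lemma imP_MX P x y : imP (P * 'X) x y = reP P x y * y + imP P x y * x.
Proof. by rewrite /imP hornerMX ImM. Qed.

(** Cauchy-Riemann equations: [u + i v] has complex derivative [u1 + i v1], hence its [y]-derivative
    is [i (u1 + i v1) = - v1 + i u1]. *)
Definition holo (u v u1 v1 : R -> R -> R) : Prop :=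
  [/\ forall x y : R, is_derive x 1 (u ^~ y) (u1 x y),
      forall x y : R, is_derive y 1 (u x) (- v1 x y),
      forall x y : R, is_derive x 1 (v ^~ y) (v1 x y),
      forall x y : R, is_derive y 1 (v x) (u1 x y) &
      jcont u /\ jcont v].

Lemma holo_poly P : holo (reP P) (imP P) (reP P^`()) (imP P^`()).
Proof.
elim/poly_ind: P => [|P c [p1 p2 p3 p4 [c1 c2]]].
  have -> : reP 0 = fun _ _ => 0 by apply/funext => x; apply/funext => y; exact: reP0.
  have -> : imP 0 = fun _ _ => 0 by apply/funext => x; apply/funext => y; exact: imP0.
  rewrite deriv0; split.
  - by move=> x y; rewrite reP0; exact: derC.
  - by move=> x y; rewrite imP0 oppr0; exact: derC.
  - by move=> x y; rewrite imP0; exact: derC.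
  - by move=> x y; rewrite reP0; exact: derC.
  - by split; exact: jcontC.
have -> : reP (P * 'X + c%:P) = fun x y => reP P x y * x - imP P x y * y + complex.Re c.
  by apply/funext => x; apply/funext => y; exact: reP_MXaddC.
have -> : imP (P * 'X + c%:P) = fun x y => reP P x y * y + imP P x y * x + complex.Im c.
  by apply/funext => x; apply/funext => y; exact: imP_MXaddC.
rewrite derivMXaddC; split.
- move=> x y; eapply is_derive_eq; first by der; [exact: p1|exact: p3].
  by rewrite rePD reP_MX /=; ring.
- move=> x y; eapply is_derive_eq; first by der; [exact: p2|exact: p4].
  by rewrite imPD imP_MX /=; ring.
- move=> x y; eapply is_derive_eq; first by der; [exact: p1|exact: p3].
  by rewrite imPD imP_MX /=; ring.
- move=> x y; eapply is_derive_eq; first by der; [exact: p2|exact: p4].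
  by rewrite rePD reP_MX /=; ring.
- by split; jc.
Qed.

Definition sqP P (x y : R) : R := reP P x y ^+ 2 + imP P x y ^+ 2.

Lemma sqP_bound P n : (size P <= n.+1)%N ->
  exists2 C, 0 <= C & forall x y, sqP P x y <= C * (1 + x ^+ 2 + y ^+ 2) ^+ n.
Proof.
elim: n P => [|n IH] P.
  move=> /size1_polyC ->; exists (sqmod P`_0); first by rewrite addr_ge0// sqr_ge0.
  by move=> x y; rewrite /sqP /reP /imP hornerC expr0 mulr1.
elim/poly_ind: P => [|P c _] sP.
  exists 0 => // x y; rewrite /sqP reP0 imP0; rewrite mul0r; lra.
have [|C C0 PC] := IH P.
  have [->|P0] := eqVneq P 0; first by rewrite size_poly0.
  by move: sP; rewrite size_MXaddC (negbTE P0)/=.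
exists (2 * C + 2 * sqmod c); first by rewrite addr_ge0// mulr_ge0// addr_ge0// sqr_ge0.
move=> x y; have := PC x y; rewrite /sqP reP_MXaddC imP_MXaddC /sqmod.
set r := reP P x y; set i := imP P x y; set t := 1 + x ^+ 2 + y ^+ 2.
set cr := complex.Re c; set ci := complex.Im c => riC.
have t1 : 1 <= t by rewrite /t; nra.
have tn1 : 1 <= t ^+ n by rewrite exprn_ege1.
have T : t * t ^+ n >= 1 by rewrite -exprS exprn_ege1.
(* This is [|P z + c|^2 <= 2 |P|^2 |z|^2 + 2 |c|^2]. *)
have h1 : (r * x - i * y + cr) ^+ 2 + (r * y + i * x + ci) ^+ 2 <=
   2 * ((r ^+ 2 + i ^+ 2) * (x ^+ 2 + y ^+ 2)) + 2 * (cr ^+ 2 + ci ^+ 2).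
  have := sqr_ge0 (r * x - i * y - cr); have := sqr_ge0 (r * y + i * x - ci); nra.
have h2 : (r ^+ 2 + i ^+ 2) * (x ^+ 2 + y ^+ 2) <= C * t ^+ n * t.
  by apply: ler_pM => //; rewrite ?addr_ge0 ?sqr_ge0// /t; lra.
have h3 : (cr ^+ 2 + ci ^+ 2) * 1 <= (cr ^+ 2 + ci ^+ 2) * (t * t ^+ n).
  by rewrite ler_wpM2l// addr_ge0// sqr_ge0.
apply: (le_trans h1); rewrite mulr1 in h3.
rewrite [leRHS](_ : _ = 2 * (C * t ^+ n * t) + 2 * ((cr ^+ 2 + ci ^+ 2) * (t * t ^+ n))).
  by rewrite lerD// ler_pM2l.
by rewrite /sqmod -/cr -/ci [t ^+ n.+1]exprS; ring.
Qed.

End Polynomials.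

(** * Identities for the pull-back of the round sphere by [H/G] *)

Section Algebra.
Variable R : realType.

(** Here [H = a + i b], [G = c + i d], and the indices 1, 2 mark derivatives. The second derivatives
    cancel in [nxx + nyy], and what remains is Lagrange's identity:
    [(|H|^2 + |G|^2)(|H'|^2 + |G'|^2)] minus [|conj H H' + conj G G'|^2] equals
    [|H G' - G H'|^2]. *)
Lemma lap_ln_identity (a b a1 b1 a2 b2 c d c1 d1 c2 d2 : R) :
  let n := a ^+ 2 + b ^+ 2 + (c ^+ 2 + d ^+ 2) in n != 0 ->
  let nx := 2 * (a * a1 + b * b1) + 2 * (c * c1 + d * d1) in
  let ny := 2 * (b * a1 - a * b1) + 2 * (d * c1 - c * d1) in
  let nxx := 2 * (a1 ^+ 2 + b1 ^+ 2 + (a * a2 + b * b2)) +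
             2 * (c1 ^+ 2 + d1 ^+ 2 + (c * c2 + d * d2)) in
  let nyy := 2 * (a1 ^+ 2 + b1 ^+ 2 - (a * a2 + b * b2)) +
             2 * (c1 ^+ 2 + d1 ^+ 2 - (c * c2 + d * d2)) in
  nxx / n - (nx / n) ^+ 2 + (nyy / n - (ny / n) ^+ 2) =
  4 * ((a * c1 - b * d1 - c * a1 + d * b1) ^+ 2 +
       (a * d1 + b * c1 - c * b1 - d * a1) ^+ 2) / n ^+ 2.
Proof.
move=> n n0 nx ny nxx nyy.
have -> : nxx / n - (nx / n) ^+ 2 + (nyy / n - (ny / n) ^+ 2) =
   ((nxx + nyy) * n - (nx ^+ 2 + ny ^+ 2)) / n ^+ 2 by field.
by congr (_ / _); rewrite /nxx /nyy /nx /ny /n; ring.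
Qed.

(** [A / n] is [(1 + h) / 2], where [h] is the height function of the unit sphere pulled back by
    [H/G]. There [|grad h|^2 = 1 - h^2], and a conformal map multiplies squared gradients by the
    area density. *)
Lemma grad_tau_identity (a b a1 b1 c d c1 d1 : R) :
  let A := a ^+ 2 + b ^+ 2 in let n := A + (c ^+ 2 + d ^+ 2) in n != 0 ->
  let Ax := 2 * (a * a1 + b * b1) in let Ay := 2 * (b * a1 - a * b1) in
  let nx := Ax + 2 * (c * c1 + d * d1) in
  let ny := Ay + 2 * (d * c1 - c * d1) in
  ((Ax * n - A * nx) / n ^+ 2) ^+ 2 + ((Ay * n - A * ny) / n ^+ 2) ^+ 2 =
  A / n * (1 - A / n) * (4 * ((a * c1 - b * d1 - c * a1 + d * b1) ^+ 2 +
       (a * d1 + b * c1 - c * b1 - d * a1) ^+ 2) / n ^+ 2).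
Proof.
move=> A n n0 Ax Ay nx ny.
have -> : ((Ax * n - A * nx) / n ^+ 2) ^+ 2 + ((Ay * n - A * ny) / n ^+ 2) ^+ 2 =
   ((Ax * n - A * nx) ^+ 2 + (Ay * n - A * ny) ^+ 2) / n ^+ 4 by field.
pose W := (a * c1 - b * d1 - c * a1 + d * b1) ^+ 2 +
       (a * d1 + b * c1 - c * b1 - d * a1) ^+ 2.
rewrite -/W.
have -> : A / n * (1 - A / n) * (4 * W / n ^+ 2) = A * (n - A) * (4 * W) / n ^+ 4 by field.
by congr (_ / _); rewrite /W /nx /ny /Ax /Ay /n /A; ring.
Qed.

(** The height function is an eigenfunction, with Laplacian [- 2 h]; conformality multiplies the
    Laplacian by the same density. *)
Lemma lap_tau_identity (a b a1 b1 a2 b2 c d c1 d1 c2 d2 : R) :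
  let A := a ^+ 2 + b ^+ 2 in let n := A + (c ^+ 2 + d ^+ 2) in n != 0 ->
  let Ax := 2 * (a * a1 + b * b1) in let Ay := 2 * (b * a1 - a * b1) in
  let nx := Ax + 2 * (c * c1 + d * d1) in
  let ny := Ay + 2 * (d * c1 - c * d1) in
  let Axx := 2 * (a1 ^+ 2 + b1 ^+ 2 + (a * a2 + b * b2)) in
  let Ayy := 2 * (a1 ^+ 2 + b1 ^+ 2 - (a * a2 + b * b2)) in
  let nxx := Axx + 2 * (c1 ^+ 2 + d1 ^+ 2 + (c * c2 + d * d2)) in
  let nyy := Ayy + 2 * (c1 ^+ 2 + d1 ^+ 2 - (c * c2 + d * d2)) in
  ((Axx * n - A * nxx) / n ^+ 2 - 2 * nx * (Ax * n - A * nx) / n ^+ 3) +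
  ((Ayy * n - A * nyy) / n ^+ 2 - 2 * ny * (Ay * n - A * ny) / n ^+ 3) =
  (1 - 2 * (A / n)) * (4 * ((a * c1 - b * d1 - c * a1 + d * b1) ^+ 2 +
       (a * d1 + b * c1 - c * b1 - d * a1) ^+ 2) / n ^+ 2).
Proof.
move=> A n n0 Ax Ay nx ny Axx Ayy nxx nyy.
have -> : ((Axx * n - A * nxx) / n ^+ 2 - 2 * nx * (Ax * n - A * nx) / n ^+ 3) +
  ((Ayy * n - A * nyy) / n ^+ 2 - 2 * ny * (Ay * n - A * ny) / n ^+ 3) =
  (((Axx + Ayy) * n - A * (nxx + nyy)) * n -
   2 * (nx * (Ax * n - A * nx) + ny * (Ay * n - A * ny))) / n ^+ 3 by field.
pose W := (a * c1 - b * d1 - c * a1 + d * b1) ^+ 2 +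
       (a * d1 + b * c1 - c * b1 - d * a1) ^+ 2.
rewrite -/W.
have -> : (1 - 2 * (A / n)) * (4 * W / n ^+ 2) = (n - 2 * A) * (4 * W) / n ^+ 3 by field.
have -> : Axx + Ayy = 4 * (a1 ^+ 2 + b1 ^+ 2) by rewrite /Axx /Ayy; ring.
have -> : nxx + nyy = 4 * (a1 ^+ 2 + b1 ^+ 2 + (c1 ^+ 2 + d1 ^+ 2)).
  by rewrite /nxx /nyy /Axx /Ayy; ring.
by congr (_ / _); rewrite /W /nx /ny /Ax /Ay /n /A; ring.
Qed.

End Algebra.

Section Jets.
Variable R : realType.
Implicit Types (f g h L N A t : R -> R -> R).

Lemma jet_sqmod (u v u1 v1 u2 v2 : R -> R -> R) :
  holo u v u1 v1 -> holo u1 v1 u2 v2 -> jcont u2 -> jcont v2 ->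
  jet (fun x y => u x y ^+ 2 + v x y ^+ 2)
    (fun x y => 2 * (u x y * u1 x y + v x y * v1 x y))
    (fun x y => 2 * (v x y * u1 x y - u x y * v1 x y))
    (fun x y => 2 * (u1 x y ^+ 2 + v1 x y ^+ 2 + (u x y * u2 x y + v x y * v2 x y)))
    (fun x y => 2 * (u1 x y ^+ 2 + v1 x y ^+ 2 - (u x y * u2 x y + v x y * v2 x y))).
Proof.
move=> [p1 p2 p3 p4 [cu cv]] [q1 q2 q3 q4 [cu1 cv1]] cu2 cv2; split.
- by move=> x y; eapply is_derive_eq; [der; [exact: p1|exact: p3]|rewrite /=; ring].
- by move=> x y; eapply is_derive_eq; [der; [exact: p2|exact: p4]|rewrite /=; ring].
- by move=> x y; eapply is_derive_eq;
    [der; [exact: p1|exact: q1|exact: p3|exact: q3]|rewrite /=; ring].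
- by move=> x y; eapply is_derive_eq;
    [der; [exact: p4|exact: q2|exact: p2|exact: q4]|rewrite /=; ring].
- by split; jc.
Qed.

Lemma jetD f fx fy fxx fyy g gx gy gxx gyy :
  jet f fx fy fxx fyy -> jet g gx gy gxx gyy ->
  jet (fun x y => f x y + g x y) (fun x y => fx x y + gx x y)
    (fun x y => fy x y + gy x y) (fun x y => fxx x y + gxx x y)
    (fun x y => fyy x y + gyy x y).
Proof.
move=> [f1 f2 f3 f4 [c0 c1 c2 c3 c4]] [g1 g2 g3 g4 [d0 d1 d2 d3 d4]]; split.
- by move=> x y; der; [exact: f1|exact: g1].
- by move=> x y; der; [exact: f2|exact: g2].
- by move=> x y; der; [exact: f3|exact: g3].
- by move=> x y; der; [exact: f4|exact: g4].
- by split; jc.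
Qed.

Lemma jet_ratioDC A Ax Ay Axx Ayy N Nx Ny Nxx Nyy (e : R) :
  (forall x y, N x y != 0) -> jet A Ax Ay Axx Ayy -> jet N Nx Ny Nxx Nyy ->
  jet (fun x y => A x y / N x y + e)
    (fun x y => (Ax x y * N x y - A x y * Nx x y) / N x y ^+ 2)
    (fun x y => (Ay x y * N x y - A x y * Ny x y) / N x y ^+ 2)
    (fun x y => (Axx x y * N x y - A x y * Nxx x y) / N x y ^+ 2
       - 2 * Nx x y * (Ax x y * N x y - A x y * Nx x y) / N x y ^+ 3)
    (fun x y => (Ayy x y * N x y - A x y * Nyy x y) / N x y ^+ 2
       - 2 * Ny x y * (Ay x y * N x y - A x y * Ny x y) / N x y ^+ 3).
Proof.
move=> N0 [f1 f2 f3 f4 [c0 c1 c2 c3 c4]] [g1 g2 g3 g4 [d0 d1 d2 d3 d4]].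
have N2 x y : N x y ^+ 2 != 0 by rewrite expf_neq0.
have N3 x y : N x y ^+ 3 != 0 by rewrite expf_neq0.
split.
- move=> x y; eapply is_derive_eq; first by der; [exact: f1|exact: N0|exact: g1].
  by rewrite /=; field.
- move=> x y; eapply is_derive_eq; first by der; [exact: f2|exact: N0|exact: g2].
  by rewrite /=; field.
- move=> x y; eapply is_derive_eq.
    by der; [exact: f3|exact: g1|exact: f1|exact: g3|exact: N2|exact: g1].
  by rewrite /=; field.
- move=> x y; eapply is_derive_eq.
    by der; [exact: f4|exact: g2|exact: f2|exact: g4|exact: N2|exact: g2].
  by rewrite /=; field.
- by split; jc.
Qed.

(** [s(t) = t - t ln t] has [s' = - ln t] and [s'' = - 1 / t], so the term [- ln t] comes with the
    Laplacian of [t] and the remainder involves only [|grad t|^2 / t]. *)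
Lemma jet_entropy t tx ty txx tyy :
  (forall x y, 0 < t x y) -> jet t tx ty txx tyy ->
  jet (fun x y => t x y - t x y * ln (t x y))
    (fun x y => - ln (t x y) * tx x y) (fun x y => - ln (t x y) * ty x y)
    (fun x y => - ln (t x y) * txx x y - tx x y ^+ 2 / t x y)
    (fun x y => - ln (t x y) * tyy x y - ty x y ^+ 2 / t x y).
Proof.
move=> t0 [f1 f2 f3 f4 [c0 c1 c2 c3 c4]].
have t0' x y : t x y != 0 by rewrite gt_eqF.
split.
- move=> x y; eapply is_derive_eq; first by der; [exact: f1|exact: f1|exact: t0|exact: f1].
  by rewrite /=; field.
- move=> x y; eapply is_derive_eq; first by der; [exact: f2|exact: f2|exact: t0|exact: f2].
  by rewrite /=; field.
- move=> x y; eapply is_derive_eq; first by der; [exact: t0|exact: f1|exact: f3].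
  by rewrite /=; field.
- move=> x y; eapply is_derive_eq; first by der; [exact: t0|exact: f2|exact: f4].
  by rewrite /=; field.
- by split; jc.
Qed.

End Jets.

Section Potential.
Variable R : realType.
Implicit Types (P : {poly R[i]}).
Notation sdens := (@sdens R).

(** By Euler's relation this is the dehomogenised [z1]-derivative of the degree [k] form with
    dehomogenisation [P], while [P'] is the [z0]-derivative; both have degree at most [k - 1]. *)
Definition euler (k : nat) P : {poly R[i]} := P *+ k - P^`() * 'X.

Lemma size_euler k P : (size P <= k.+1)%N -> (size (euler k P) <= k)%N.
Proof.
move=> sP; apply/leq_sizeP => j kj; rewrite coefB coefMn coefMX.
have [jk|jk] := eqVneq j k; last first.
  have Pj : P`_j = 0 by move/leq_sizeP: sP; apply; rewrite ltn_neqAle eq_sym jk.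
  rewrite Pj mul0rn sub0r; case: j jk kj Pj => [|j] /= _ _ Pj; first by rewrite oppr0.
  by rewrite coef_deriv Pj mul0rn oppr0.
subst j; case: k {sP kj} => [|k] /=; first by rewrite mulr0n subr0.
by rewrite coef_deriv subrr.
Qed.

Lemma ReMn (z : R[i]) k : complex.Re (z *+ k) = complex.Re z *+ k.
Proof. by elim: k => [|k IH]; rewrite ?mulr0n// !mulrS ReD IH. Qed.

Lemma ImMn (z : R[i]) k : complex.Im (z *+ k) = complex.Im z *+ k.
Proof. by elim: k => [|k IH]; rewrite ?mulr0n// !mulrS ImD IH. Qed.

Lemma ReN (z : R[i]) : complex.Re (- z) = - complex.Re z.
Proof. by case: z. Qed.

Lemma ImN (z : R[i]) : complex.Im (- z) = - complex.Im z.
Proof. by case: z. Qed.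

Lemma rePeuler k P x y : reP (euler k P) x y =
  k%:R * reP P x y - (reP P^`() x y * x - imP P^`() x y * y).
Proof.
by rewrite {1}/reP /euler hornerD hornerN ReD ReN hornerMn ReMn mulr_natl
   -/(reP (P^`() * 'X) x y) reP_MX.
Qed.

Lemma imPeuler k P x y : imP (euler k P) x y =
  k%:R * imP P x y - (reP P^`() x y * y + imP P^`() x y * x).
Proof.
by rewrite {1}/imP /euler hornerD hornerN ImD ImN hornerMn ImMn mulr_natl
   -/(imP (P^`() * 'X) x y) imP_MX.
Qed.

(** With [E_P = k P - z P'] one has [k (H G' - G H') = E_H G' - E_G H'], a Jacobian of the
    homogeneous pair. Every factor on the right has degree at most [k - 1], which gains one degree
    over the naive bound for [H G']. *)
Lemma wronsk_bound (a b a1 b1 c d c1 d1 k x y C : R) : 1 <= k -> 0 <= C ->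
  a1 ^+ 2 + b1 ^+ 2 <= C -> c1 ^+ 2 + d1 ^+ 2 <= C ->
  (k * a - (a1 * x - b1 * y)) ^+ 2 + (k * b - (a1 * y + b1 * x)) ^+ 2 <= C ->
  (k * c - (c1 * x - d1 * y)) ^+ 2 + (k * d - (c1 * y + d1 * x)) ^+ 2 <= C ->
  (a * c1 - b * d1 - c * a1 + d * b1) ^+ 2 +
  (a * d1 + b * c1 - c * b1 - d * a1) ^+ 2 <= 4 * C ^+ 2.
Proof.
move=> k1 C0; set a0 := (k * a - _); set b0 := (k * b - _).
set c0 := (k * c - _); set d0 := (k * d - _) => A1 C1 A0 C0'.
set W := (X in X <= _).
have W0 : 0 <= W by rewrite addr_ge0 ?sqr_ge0.
have WE : k ^+ 2 * W = (a0 * c1 - b0 * d1 - c0 * a1 + d0 * b1) ^+ 2 +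
  (a0 * d1 + b0 * c1 - c0 * b1 - d0 * a1) ^+ 2.
  by rewrite /W /a0 /b0 /c0 /d0; ring.
have h1 : k ^+ 2 * W <= 2 * ((a0 ^+ 2 + b0 ^+ 2) * (c1 ^+ 2 + d1 ^+ 2))
   + 2 * ((c0 ^+ 2 + d0 ^+ 2) * (a1 ^+ 2 + b1 ^+ 2)).
  rewrite WE -subr_ge0.
  rewrite (_ : _ - _ = (a0 * c1 - b0 * d1 + c0 * a1 - d0 * b1) ^+ 2 +
  (a0 * d1 + b0 * c1 + c0 * b1 + d0 * a1) ^+ 2); first by rewrite addr_ge0 ?sqr_ge0.
  by ring.
have h2 : (a0 ^+ 2 + b0 ^+ 2) * (c1 ^+ 2 + d1 ^+ 2) <= C * C.
  by apply: ler_pM => //; rewrite addr_ge0 ?sqr_ge0.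
have h3 : (c0 ^+ 2 + d0 ^+ 2) * (a1 ^+ 2 + b1 ^+ 2) <= C * C.
  by apply: ler_pM => //; rewrite addr_ge0 ?sqr_ge0.
have h4 : W <= k ^+ 2 * W by rewrite ler_peMl// exprn_ege1.
by rewrite expr2; lra.
Qed.

(* [N_x (1 + |z|^2) - 2 k x N] is [2 Re (conj H E_H + conj G E_G)] with
   [E_P = P' (1 + |z|^2) - k conj(z) P = P' - conj(z) (k P - z P')]. *)
Lemma grad_psi_bound (a b a1 b1 c d c1 d1 k x y C : R) : 0 <= C ->
  let s := 1 + x ^+ 2 + y ^+ 2 in
  let n := a ^+ 2 + b ^+ 2 + (c ^+ 2 + d ^+ 2) in
  let nx := 2 * (a * a1 + b * b1) + 2 * (c * c1 + d * d1) in
  let ny := 2 * (b * a1 - a * b1) + 2 * (d * c1 - c * d1) in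
  a1 ^+ 2 + b1 ^+ 2 <= C -> c1 ^+ 2 + d1 ^+ 2 <= C ->
  (k * a - (a1 * x - b1 * y)) ^+ 2 + (k * b - (a1 * y + b1 * x)) ^+ 2 <= C ->
  (k * c - (c1 * x - d1 * y)) ^+ 2 + (k * d - (c1 * y + d1 * x)) ^+ 2 <= C ->
  (nx * s - k * (2 * x) * n) ^+ 2 <= 16 * C * s * n /\
  (ny * s - k * (2 * y) * n) ^+ 2 <= 16 * C * s * n.
Proof.
move=> C0 s n nx ny; set a0 := (k * a - _); set b0 := (k * b - _).
set c0 := (k * c - _); set d0 := (k * d - _) => A1 C1 A0 C0'.
pose ea := a1 - (a0 * x + b0 * y); pose eb := b1 - (b0 * x - a0 * y).
pose ec := c1 - (c0 * x + d0 * y); pose ed := d1 - (d0 * x - c0 * y).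
have xE : nx * s - k * (2 * x) * n = 2 * (a * ea + b * eb + (c * ec + d * ed)).
  by rewrite /nx /s /n /ea /eb /ec /ed /a0 /b0 /c0 /d0; ring.
have yE : ny * s - k * (2 * y) * n = 2 * (b * ea - a * eb + (d * ec - c * ed)).
  by rewrite /ny /s /n /ea /eb /ec /ed /a0 /b0 /c0 /d0; ring.
have n0 : 0 <= n by rewrite !addr_ge0 ?sqr_ge0.
have s1 : 1 <= s by rewrite /s; nra.
have E (u v u0 v0 : R) : u ^+ 2 + v ^+ 2 <= C -> u0 ^+ 2 + v0 ^+ 2 <= C ->
    (u - (u0 * x + v0 * y)) ^+ 2 + (v - (v0 * x - u0 * y)) ^+ 2 <= 2 * C * s.
  move=> uv u0v0.
  have : (u0 ^+ 2 + v0 ^+ 2) * (x ^+ 2 + y ^+ 2) <= C * (x ^+ 2 + y ^+ 2).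
    by rewrite ler_wpM2r// addr_ge0 ?sqr_ge0.
  have := sqr_ge0 (u + (u0 * x + v0 * y)); have := sqr_ge0 (v + (v0 * x - u0 * y)).
  rewrite /s => h1 h2 h3; lra.
have EA := E _ _ _ _ A1 A0; have EC := E _ _ _ _ C1 C0'.
have CS (p q r t p' q' r' t' : R) : (p * p' + q * q' + (r * r' + t * t')) ^+ 2 <=
   (p ^+ 2 + q ^+ 2 + (r ^+ 2 + t ^+ 2)) * (p' ^+ 2 + q' ^+ 2 + (r' ^+ 2 + t' ^+ 2)).
  rewrite -subr_ge0 (_ : _ - _ = (p * q' - q * p') ^+ 2 + (p * r' - r * p') ^+ 2 +
    (p * t' - t * p') ^+ 2 + (q * r' - r * q') ^+ 2 + (q * t' - t * q') ^+ 2 +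
    (r * t' - t * r') ^+ 2); first by rewrite !addr_ge0 ?sqr_ge0.
  by ring.
have F : n * (ea ^+ 2 + eb ^+ 2 + (ec ^+ 2 + ed ^+ 2)) <= n * (4 * C * s).
  apply: ler_wpM2l => //; rewrite /ea /eb /ec /ed; lra.
rewrite xE yE; split.
- by have := CS a b c d ea eb ec ed; rewrite -/n exprMn; lra.
- have := CS b a d c ea (- eb) ec (- ed).
  have -> : b ^+ 2 + a ^+ 2 + (d ^+ 2 + c ^+ 2) = n by rewrite /n; ring.
  by rewrite !sqrrN !mulrN exprMn; lra.
Qed.

End Potential.

(** * The potential [psi] and the entropy of [tau], for a pair of degree [k = n + 1] *)

Section Potential.
Variable R : realType.
Variables (H G : {poly R[i]}) (n : nat) (eta B : R).
Hypotheses (sH : (size H <= n.+2)%N) (sG : (size G <= n.+2)%N) (eta0 : 0 < eta).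
Notation sdens := (@sdens R).
Notation onesq x y := (1 + x ^+ 2 + y ^+ 2).

Definition normHG x y : R := sqP H x y + sqP G x y.

Definition wronskHG x y : R :=
  (reP H x y * reP G^`() x y - imP H x y * imP G^`() x y
   - reP G x y * reP H^`() x y + imP G x y * imP H^`() x y) ^+ 2 +
  (reP H x y * imP G^`() x y + imP H x y * reP G^`() x y
   - reP G x y * imP H^`() x y - imP G x y * reP H^`() x y) ^+ 2.

(* Density of the pull-back by [H / G] of the round area form. *)
Definition pullback x y : R := 4 * wronskHG x y / normHG x y ^+ 2.

Hypothesis annulus : forall x y : R,
  eta * onesq x y ^+ n.+1 <= normHG x y <= B * onesq x y ^+ n.+1.

Lemma normHG_gt0 x y : 0 < normHG x y.
Proof.
have /andP[+ _] := annulus x y; apply: lt_le_trans.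
by rewrite mulr_gt0// exprn_gt0// onesq_gt0.
Qed.

Lemma pullback_ge0 x y : 0 <= pullback x y.
Proof. by rewrite divr_ge0 ?sqr_ge0// mulr_ge0// addr_ge0 ?sqr_ge0. Qed.

(** The constant depends on [H] and [G]. It only certifies decay for Green's formula and never
    reaches the final estimate. *)
Lemma deriv_bounds : exists2 C : R, 0 <= C & forall x y,
  [/\ sqP H^`() x y <= C * onesq x y ^+ n, sqP G^`() x y <= C * onesq x y ^+ n,
      sqP (euler n.+1 H) x y <= C * onesq x y ^+ n &
      sqP (euler n.+1 G) x y <= C * onesq x y ^+ n].
Proof.
have sder (P : {poly R[i]}) : (size P <= n.+2)%N -> (size (deriv P) <= n.+1)%N.
  move=> /leq_sizeP sP; apply/leq_sizeP => j nj.
  by rewrite coef_deriv sP// mul0rn.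
have [C1 C10 H1] := sqP_bound (sder _ sH).
have [C2 C20 H2] := sqP_bound (sder _ sG).
have [C3 C30 H3] := sqP_bound (size_euler sH).
have [C4 C40 H4] := sqP_bound (size_euler sG).
exists (C1 + C2 + C3 + C4); first by rewrite !addr_ge0.
move=> x y; have p0 : 0 <= onesq x y ^+ n by rewrite exprn_ge0// ltW// onesq_gt0.
split; [apply: le_trans (H1 x y) _|apply: le_trans (H2 x y) _|
  apply: le_trans (H3 x y) _|apply: le_trans (H4 x y) _]; apply: ler_wpM2r => //; lra.
Qed.

(** With [s = 1 + |z|^2], the numerator grows at most like [s^(2n)] and the denominator at least
    like [s^(2n+2)], so the quotient decays like [sdens]. *)
Lemma pullback_bound : exists C, forall x y, pullback x y <= C * sdens x y.
Proof.
have [C C0 bC] := deriv_bounds; exists (4 * C ^+ 2 / eta ^+ 2) => x y.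
have [h1 h2 h3 h4] := bC x y; have s0 := onesq_gt0 x y.
set p := onesq x y ^+ n in h1 h2 h3 h4.
have p0 : 0 < p by rewrite exprn_gt0.
have W : wronskHG x y <= 4 * (C * p) ^+ 2.
  apply: (@wronsk_bound _ _ _ _ _ _ _ _ _ n.+1%:R x y) => //.
  - by rewrite ler1n.
  - by rewrite mulr_ge0// ltW.
  - by rewrite -rePeuler -imPeuler.
  - by rewrite -rePeuler -imPeuler.
have N : eta * onesq x y * p <= normHG x y.
  by have /andP[+ _] := annulus x y; rewrite exprS mulrA.
have e0 : 0 < eta * onesq x y * p by rewrite !mulr_gt0.
rewrite /pullback ler_pdivrMr ?exprn_gt0 ?normHG_gt0//.
have -> : 4 * C ^+ 2 / eta ^+ 2 * sdens x y * normHG x y ^+ 2 =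
  4 * (4 * (C * p) ^+ 2) * (normHG x y / (eta * onesq x y * p)) ^+ 2.
  by rewrite /sdens; field; rewrite !gt_eqF.
apply: le_trans (_ : 4 * (4 * (C * p) ^+ 2) * 1 <= _); first by rewrite mulr1 ler_pM2l.
apply: ler_wpM2l; first by apply: mulr_ge0 => //; apply: mulr_ge0 => //; exact: sqr_ge0.
by rewrite exprn_ege1// ler_pdivlMr// mul1r.
Qed.

Lemma jet_sqP (P : {poly R[i]}) : jet (sqP P)
    (fun x y => 2 * (reP P x y * reP P^`() x y + imP P x y * imP P^`() x y))
    (fun x y => 2 * (imP P x y * reP P^`() x y - reP P x y * imP P^`() x y))
    (fun x y => 2 * (reP P^`() x y ^+ 2 + imP P^`() x y ^+ 2 +
       (reP P x y * reP P^`()^`() x y + imP P x y * imP P^`()^`() x y)))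
    (fun x y => 2 * (reP P^`() x y ^+ 2 + imP P^`() x y ^+ 2 -
       (reP P x y * reP P^`()^`() x y + imP P x y * imP P^`()^`() x y))).
Proof.
have [_ _ _ _ [c1 c2]] := holo_poly P^`()^`().
exact: jet_sqmod (holo_poly P) (holo_poly P^`()) c1 c2.
Qed.

Let px (P : {poly R[i]}) (x y : R) : R :=
  2 * (reP P x y * reP P^`() x y + imP P x y * imP P^`() x y).
Let py (P : {poly R[i]}) (x y : R) : R :=
  2 * (imP P x y * reP P^`() x y - reP P x y * imP P^`() x y).
Let pxx (P : {poly R[i]}) (x y : R) : R := 2 * (reP P^`() x y ^+ 2 + imP P^`() x y ^+ 2 +
       (reP P x y * reP P^`()^`() x y + imP P x y * imP P^`()^`() x y)).
Let pyy (P : {poly R[i]}) (x y : R) : R := 2 * (reP P^`() x y ^+ 2 + imP P^`() x y ^+ 2 -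
       (reP P x y * reP P^`()^`() x y + imP P x y * imP P^`()^`() x y)).
Let nx (x y : R) : R := px H x y + px G x y.
Let ny (x y : R) : R := py H x y + py G x y.
Let nxx (x y : R) : R := pxx H x y + pxx G x y.
Let nyy (x y : R) : R := pyy H x y + pyy G x y.

Let jet_sqH : jet (sqP H) (px H) (py H) (pxx H) (pyy H).
Proof. exact: jet_sqP. Qed.

Let jet_norm : jet normHG nx ny nxx nyy.
Proof. exact: jetD (jet_sqP H) (jet_sqP G). Qed.

Definition psiHG x y : R := ln (normHG x y) - n.+1%:R * ln (onesq x y).

Lemma psiHG_bounds x y : ln eta <= psiHG x y <= ln B.
Proof.
have s0 := onesq_gt0 x y; have p0 := exprn_gt0 n.+1 s0; have N0 := normHG_gt0 x y.
have /andP[h1 h2] := annulus x y.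
have B0 : 0 < B by rewrite -(pmulr_lgt0 _ p0); exact: lt_le_trans h2.
rewrite /psiHG mulr_natl -lnXn// lerBrDr lerBlDr -!lnM ?posrE//.
by rewrite !ler_ln ?posrE// ?mulr_gt0// h1.
Qed.

Lemma tame_psi : tame psiHG (fun x y => pullback x y - n.+1%:R * sdens x y).
Proof.
have s0 := @onesq_gt0 R; have N0 := normHG_gt0.
have jL := jetB_scale n.+1%:R (jet_ln N0 jet_norm) (@jet_ln_onesq R).
have [C bC] := pullback_bound; have [D D0 bD] := deriv_bounds.
(* [grad_psi_bound] bounds the squared numerator by [16 D s^(n+1) N], with [s = 1 + |z|^2] and
   [N = normHG]; the lower annulus bound [s^(n+1) <= N / eta] turns this into [K^2 N^2]. *)
pose K := Num.sqrt (16 * D / eta).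
have K2 : K ^+ 2 = 16 * D / eta by rewrite sqr_sqrtr// divr_ge0 ?mulr_ge0// ltW.
have K0 : 0 <= K by exact: sqrtr_ge0.
have grad (x y t : R) : t ^+ 2 <= 16 * (D * onesq x y ^+ n) * onesq x y * normHG x y ->
    `|t / (normHG x y * onesq x y)| <= K / onesq x y.
  move=> tN; rewrite normrM normfV (gtr0_norm (mulr_gt0 (N0 x y) (s0 x y))).
  rewrite ler_pdivrMr ?mulr_gt0// mulrCA divfK ?gt_eqF//.
  rewrite -ler_sqr ?nnegrE ?mulr_ge0 ?(ltW (N0 x y))// real_normK ?num_real//.
  apply: (le_trans tN); rewrite exprMn K2.
  have /andP[h _] := annulus x y; rewrite exprS in h.
  have -> : normHG x y ^+ 2 * (16 * D / eta) =
      16 * D * normHG x y * (normHG x y / eta) by field; rewrite gt_eqF.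
  have -> : 16 * (D * onesq x y ^+ n) * onesq x y * normHG x y =
    16 * D * normHG x y * (onesq x y * onesq x y ^+ n) by ring.
  apply: ler_wpM2l; first by rewrite !mulr_ge0// (ltW (N0 x y)).
  by rewrite ler_pdivlMr// mulrC.
have bG (x y : R) :
    (nx x y * onesq x y - n.+1%:R * (2 * x) * normHG x y) ^+ 2 <=
      16 * (D * onesq x y ^+ n) * onesq x y * normHG x y /\
    (ny x y * onesq x y - n.+1%:R * (2 * y) * normHG x y) ^+ 2 <=
      16 * (D * onesq x y ^+ n) * onesq x y * normHG x y.
  have [h1 h2 h3 h4] := bD x y; rewrite /sqP rePeuler imPeuler in h3.
  rewrite /sqP rePeuler imPeuler in h4.
  exact: (grad_psi_bound (mulr_ge0 D0 (exprn_ge0 n (ltW (s0 x y)))) h1 h2 h3 h4).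
apply: (tame_intro (C0 := `|ln eta| + `|ln B|) (C1 := K)
  (C2 := `|C| + n.+1%:R) jL).
- move=> x y.
  have := @lap_ln_identity _ (reP H x y) (imP H x y) (reP H^`() x y)
    (imP H^`() x y) (reP H^`()^`() x y) (imP H^`()^`() x y)
    (reP G x y) (imP G x y) (reP G^`() x y) (imP G^`() x y) (reP G^`()^`() x y)
    (imP G^`()^`() x y) (lt0r_neq0 (N0 x y)).
  rewrite -!/(px _ x y) -!/(py _ x y) -!/(pxx _ x y) -!/(pyy _ x y) -/(nx x y) -/(ny x y)
    -/(nxx x y) -/(nyy x y) -/(sqP _ x y) -/(normHG x y) -/(wronskHG x y) -/(pullback x y).
  move=> <-; have := gt_eqF (s0 x y); have := gt_eqF (N0 x y); rewrite /sdens.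
  by set N := normHG x y => N0' S0'; field; rewrite N0' S0'.
- move=> x y; have /andP[h1 h2] := psiHG_bounds x y.
  have := ler_norm (ln B); have := ler_norm (- ln eta); rewrite normrN => *.
  have := normr_ge0 (ln B); have := normr_ge0 (ln eta) => *.
  by rewrite -/(psiHG x y) ler_norml; apply/andP; split; lra.
- move=> x y; have [h _] := bG x y.
  have -> : nx x y / normHG x y - n.+1%:R * (2 * x / onesq x y) =
    (nx x y * onesq x y - n.+1%:R * (2 * x) * normHG x y) / (normHG x y * onesq x y).
    by field; rewrite (gt_eqF (N0 x y)) gt_eqF.
  exact: grad.
- move=> x y; have [_ h] := bG x y.
  have -> : ny x y / normHG x y - n.+1%:R * (2 * y / onesq x y) =
    (ny x y * onesq x y - n.+1%:R * (2 * y) * normHG x y) / (normHG x y * onesq x y).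
    by field; rewrite (gt_eqF (N0 x y)) gt_eqF.
  exact: grad.
- move=> x y; rewrite (le_trans (ler_normB _ _))// [leRHS]mulrDl lerD//.
    rewrite ger0_norm ?pullback_ge0// (le_trans (bC x y))//.
    by rewrite ler_pM2r ?sdens_gt0// ler_norm.
  by rewrite ger0_norm// mulr_ge0// ltW// sdens_gt0.
Qed.

Definition tauHG x y : R := sqP H x y / normHG x y.

Lemma tauHG_bounds x y : 0 <= tauHG x y <= 1.
Proof.
have N0 := normHG_gt0 x y; have A0 P : 0 <= sqP P x y by rewrite addr_ge0 ?sqr_ge0.
rewrite /tauHG divr_ge0 ?(ltW N0) ?A0//=.
by rewrite ler_pdivrMr// mul1r lerDl A0.
Qed.

Let tx (x y : R) : R := (px H x y * normHG x y - sqP H x y * nx x y) / normHG x y ^+ 2.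
Let ty (x y : R) : R := (py H x y * normHG x y - sqP H x y * ny x y) / normHG x y ^+ 2.
Let txx (x y : R) : R := (pxx H x y * normHG x y - sqP H x y * nxx x y) / normHG x y ^+ 2
      - 2 * nx x y * (px H x y * normHG x y - sqP H x y * nx x y) / normHG x y ^+ 3.
Let tyy (x y : R) : R := (pyy H x y * normHG x y - sqP H x y * nyy x y) / normHG x y ^+ 2
      - 2 * ny x y * (py H x y * normHG x y - sqP H x y * ny x y) / normHG x y ^+ 3.

(** The shift [delta] keeps the logarithm finite at the zeros of [H]. It leaves the gradient and the
    Laplacian of [tau] unchanged, so both identities for [tau] still apply; only the divisor in the
    gradient term becomes [tau + delta]. *)
Lemma tame_entropy (delta : R) : 0 < delta ->
  tame (fun x y => tauHG x y + delta - (tauHG x y + delta) * ln (tauHG x y + delta))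
    (fun x y => pullback x y * (- (1 - 2 * tauHG x y) * ln (tauHG x y + delta)
       - tauHG x y * (1 - tauHG x y) / (tauHG x y + delta))).
Proof.
move=> d0; have s0 := @onesq_gt0 R; have N0 := normHG_gt0.
have N0' x y : normHG x y != 0 by rewrite gt_eqF.
have tb := tauHG_bounds.
have t0 x y : 0 < tauHG x y + delta by have /andP[] := tb x y; lra.
have jt : jet (fun x y => tauHG x y + delta) tx ty txx tyy.
  exact: jet_ratioDC N0' jet_sqH jet_norm.
have jE := jet_entropy t0 jt.
have [C bC] := pullback_bound.
pose K := `|ln delta| + `|ln (1 + delta)|.
have lnK x y : `|ln (tauHG x y + delta)| <= K.
  have /andP[u0 u1] := tb x y; have t0' := t0 x y.
  have h1 : ln delta <= ln (tauHG x y + delta) by rewrite ler_ln ?posrE//; lra.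
  have h2 : ln (tauHG x y + delta) <= ln (1 + delta) by rewrite ler_ln ?posrE//; lra.
  have := ler_norm (ln (1 + delta)); have := ler_norm (- ln delta); rewrite normrN => *.
  have := normr_ge0 (ln (1 + delta)); have := normr_ge0 (ln delta) => *.
  by rewrite /K ler_norml; apply/andP; split; lra.
have K0 : 0 <= K by rewrite addr_ge0.
have gradt (x y : R) : tx x y ^+ 2 + ty x y ^+ 2 =
    tauHG x y * (1 - tauHG x y) * pullback x y.
  exact: (grad_tau_identity (reP H^`() x y) (imP H^`() x y)
    (reP G^`() x y) (imP G^`() x y) (lt0r_neq0 (N0 x y))).
have lapt (x y : R) : txx x y + tyy x y = (1 - 2 * tauHG x y) * pullback x y.
  exact: (lap_tau_identity (reP H^`() x y) (imP H^`() x y)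
    (reP H^`()^`() x y) (imP H^`()^`() x y) (reP G^`() x y) (imP G^`() x y)
    (reP G^`()^`() x y) (imP G^`()^`() x y) (lt0r_neq0 (N0 x y))).
have C0 : 0 <= C.
  by have := le_trans (pullback_ge0 0 0) (bC 0 0); rewrite pmulr_lge0// sdens_gt0.
(* Since [tau (1 - tau) <= 1], each partial derivative of [tau] is at most [sqrt (C * sdens) = 2
   sqrt C / (1 + |z|^2)]. *)
have gb (x y a : R) : a ^+ 2 <= tauHG x y * (1 - tauHG x y) * pullback x y ->
    `|- ln (tauHG x y + delta) * a| <= K * (2 * Num.sqrt C) / onesq x y.
  move=> ha; rewrite normrM normrN -mulrA ler_pM//.
  have /andP[u0 u1] := tb x y; have p0 := pullback_ge0 x y.
  rewrite -ler_sqr ?nnegrE ?divr_ge0 ?mulr_ge0 ?sqrtr_ge0 ?(ltW (s0 x y))//.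
  rewrite real_normK ?num_real// (le_trans ha)//.
  have -> : (2 * Num.sqrt C / onesq x y) ^+ 2 = C * sdens x y.
    by rewrite /sdens -{2}(sqr_sqrtr C0); field; rewrite gt_eqF.
  rewrite (le_trans _ (bC x y))// ler_piMl//; nra.
apply: (tame_intro (C0 := (1 + delta) * (1 + K)) (C1 := K * (2 * Num.sqrt C))
  (C2 := (K + delta^-1) * C) jE).
- move=> x y.
  rewrite (_ : pullback x y * _ = - ln (tauHG x y + delta) * (txx x y + tyy x y)
    - (tx x y ^+ 2 + ty x y ^+ 2) / (tauHG x y + delta)); first by ring.
  by rewrite lapt gradt; ring.
- move=> x y; have /andP[u0 u1] := tb x y.
  rewrite (le_trans (ler_normB _ _))// normrM (gtr0_norm (t0 x y)).
  by rewrite [leRHS]mulrDr mulr1 lerD ?ler_pM//; lra.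
- by move=> x y; apply: gb; rewrite -gradt lerDl sqr_ge0.
- by move=> x y; apply: gb; rewrite -gradt lerDr sqr_ge0.
- move=> x y; have /andP[u0 u1] := tb x y; have p0 := pullback_ge0 x y.
  rewrite normrM (ger0_norm p0) mulrC -[leRHS]mulrA ler_pM//.
  rewrite (le_trans (ler_normB _ _))// lerD//.
    rewrite normrM -[leRHS]mul1r ler_pM//.
    by rewrite normrN ler_norml; apply/andP; split; lra.
  rewrite normrM normfV (gtr0_norm (t0 x y)) -[leRHS]mul1r ler_pM//.
  - by rewrite invr_ge0 ltW// t0.
  - rewrite ger0_norm; nra.
  - rewrite lef_pV2 ?posrE ?t0//; lra.
Qed.

End Potential.

(** * Functions of class C2 on the sphere *)

Section ChainRule.
Variable R : realType.
Implicit Types (g : R -> R -> R).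

Lemma mean_value (f df : R -> R) : (forall x : R, is_derive x 1 f (df x)) ->
  forall u u0, exists xi, `|xi - u0| <= `|u - u0| /\ f u - f u0 = df xi * (u - u0).
Proof.
move=> fd u u0.
have cf : continuous f by apply: ders_continuous => x; exists (df x).
have [uu|/ltW uu] := leP u0 u.
  have [xi] := @MVT_segment _ f df u0 u uu (fun x _ => fd x) (continuous_subspaceT cf).
  rewrite in_itv/= => /andP[h1 h2] ->; exists xi; split=> //.
  by rewrite !ger0_norm; lra.
have [xi] := @MVT_segment _ f df u u0 uu (fun x _ => fd x) (continuous_subspaceT cf).
rewrite in_itv/= => /andP[h1 h2] h; exists xi; split.
  by rewrite !ler0_norm; lra.
by rewrite -opprB h; ring.
Qed.

(** The increment is split along a horizontal and then a vertical segment, and the mean value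
    theorem is applied on each. The intermediate points, picked by choice, are squeezed to the base
    point; continuity of the partial derivatives then gives continuity of the slopes there. *)
Lemma caratheodory2 g gx gy (u0 v0 : R) :
  (forall x y : R, is_derive x 1 (g ^~ y) (gx x y)) ->
  (forall x y : R, is_derive y 1 (g x) (gy x y)) -> jcont gx -> jcont gy ->
  exists p q : R * R -> R,
  [/\ forall u v, g u v - g u0 v0 = p (u, v) * (u - u0) + q (u, v) * (v - v0),
      {for (u0, v0), continuous p}, {for (u0, v0), continuous q},
      p (u0, v0) = gx u0 v0 & q (u0, v0) = gy u0 v0].
Proof.
move=> dx dy cx cy.
have /choice[xi xiP] : forall w : R * R, exists xi,
    `|xi - u0| <= `|w.1 - u0| /\ g w.1 w.2 - g u0 w.2 = gx xi w.2 * (w.1 - u0).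
  by move=> w; exact: (mean_value (fun x => dx x w.2)).
have /choice[ze zeP] : forall w : R * R, exists ze,
    `|ze - v0| <= `|w.2 - v0| /\ g u0 w.2 - g u0 v0 = gy u0 ze * (w.2 - v0).
  by move=> w; exact: (mean_value (fun y => dy u0 y)).
have xi0 : xi (u0, v0) = u0.
  by have [/=] := xiP (u0, v0); rewrite subrr normr0 normr_le0 subr_eq0 => /eqP.
have ze0 : ze (u0, v0) = v0.
  by have [/=] := zeP (u0, v0); rewrite subrr normr0 normr_le0 subr_eq0 => /eqP.
have cxi : {for (u0, v0), continuous xi}.
  rewrite /prop_for /continuous_at xi0; apply/cvgrPdist_le => e e0.
  have /cvgrPdist_le/(_ e e0) : w.1 @[w --> (u0, v0)] --> u0 by exact: cvg_fst.
  apply: filterS => w h; have [xw _] := xiP w.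
  by rewrite distrC (le_trans xw)// distrC.
have cze : {for (u0, v0), continuous ze}.
  rewrite /prop_for /continuous_at ze0; apply/cvgrPdist_le => e e0.
  have /cvgrPdist_le/(_ e e0) : w.2 @[w --> (u0, v0)] --> v0 by exact: cvg_snd.
  apply: filterS => w h; have [zw _] := zeP w.
  by rewrite distrC (le_trans zw)// distrC.
exists (fun w => gx (xi w) w.2), (fun w => gy u0 (ze w)); split.
- move=> u v; have [_ /= <-] := xiP (u, v); have [_ /= <-] := zeP (u, v); ring.
- apply: (@continuous_comp _ _ _ (fun w => (xi w, w.2)) (fun q => gx q.1 q.2)).
    apply: (@cvg_pair _ _ _ (nbhs (u0, v0)) (nbhs (xi (u0, v0))) (nbhs v0) _ _ _ xi snd) => //.
    exact: cvg_snd.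
  exact: cx.
- apply: (@continuous_comp _ _ _ (fun w => (u0, ze w)) (fun q => gy q.1 q.2)).
    apply: (@cvg_pair _ _ _ (nbhs (u0, v0)) (nbhs u0) (nbhs (ze (u0, v0))) _ _ _ (cst u0) ze) => //.
    exact: cvg_cst.
  exact: cy.
- by rewrite xi0.
- by rewrite ze0.
Qed.

Lemma chain_rule2 g gx gy (a b : R -> R) (t a1 b1 : R) :
  (forall x y : R, is_derive x 1 (g ^~ y) (gx x y)) ->
  (forall x y : R, is_derive y 1 (g x) (gy x y)) -> jcont gx -> jcont gy ->
  is_derive t 1 a a1 -> is_derive t 1 b b1 ->
  is_derive t 1 (fun s => g (a s) (b s)) (gx (a t) (b t) * a1 + gy (a t) (b t) * b1).
Proof.
move=> dx dy cx cy da db.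
have ca := der_continuous da; have cb := der_continuous db.
have [p [q [pq cp cq p0 q0]]] := caratheodory2 (a t) (b t) dx dy cx cy.
move: da db => /is_derive1_caratheodory[al [aE cal <-]].
move=> /is_derive1_caratheodory[be [bE cbe <-]].
apply/is_derive1_caratheodory.
have cab : (fun s => (a s, b s)) @ t --> (a t, b t).
  exact: (@cvg_pair _ _ _ (nbhs t) (nbhs (a t)) (nbhs (b t)) _ _ _ a b ca cb).
exists (fun s => p (a s, b s) * al s + q (a s, b s) * be s); split.
- by move=> z; rewrite pq aE bE; ring.
- apply: cvgD; apply: cvgM => //.
  + exact: (@continuous_comp _ _ _ (fun s => (a s, b s)) p t cab cp).
  + exact: (@continuous_comp _ _ _ (fun s => (a s, b s)) q t cab cq).
- by rewrite p0 q0.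
Qed.

End ChainRule.

Section SphereFunctions.
Variable R : realType.
Implicit Types (g fa : R -> R -> R).
Notation sdens := (@sdens R).

Lemma is_derive_pdx g (x y : R) : has_partials g -> is_derive x 1 (g ^~ y) (pdx g x y).
Proof.
move=> dg.
have [h _] := dg x y.
rewrite /pdx derive1E.
exact: derivableP h.
Qed.

Lemma is_derive_pdy g (x y : R) : has_partials g -> is_derive y 1 (g x) (pdy g x y).
Proof. by move=> dg; have [_ h] := dg x y; rewrite /pdy derive1E; exact: derivableP h. Qed.

Lemma C2_jet g : C2 g -> jet g (pdx g) (pdy g) (pdx (pdx g)) (pdy (pdy g)).
Proof.
move=> [h0 [hx [hy [c [cx [cy [cxx [_ [_ cyy]]]]]]]]].
split.
- by move=> x y; exact: is_derive_pdx.
- by move=> x y; exact: is_derive_pdy.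
- by move=> x y; exact: is_derive_pdx.
- by move=> x y; exact: is_derive_pdy.
- by split.
Qed.

Lemma chart_infE fa finf (x y : R) : x ^+ 2 + y ^+ 2 != 0 ->
  fa x y = chart_inf fa finf (x / (x ^+ 2 + y ^+ 2)) (- y / (x ^+ 2 + y ^+ 2)).
Proof.
set s := x ^+ 2 + y ^+ 2 => s0; rewrite /chart_inf ifF; last first.
  apply/negP => /andP[]; rewrite !mulf_eq0 oppr_eq0 invr_eq0 (negbTE s0) !orbF.
  by move=> /eqP x0 /eqP y0; move: s0; rewrite /s x0 y0 expr0n addr0 eqxx.
have -> : (x / s) ^+ 2 + (- y / s) ^+ 2 = s^-1.
  by rewrite -[in RHS](mulfK (expf_neq0 2 s0) s^-1) /s; field.
by congr fa; field.
Qed.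

Lemma jcont_chart_limit fa finf (e : R) : 0 < e -> jcont (chart_inf fa finf) ->
  exists2 rho, 0 < rho & forall x y, rho <= x ^+ 2 + y ^+ 2 -> `|fa x y - finf| <= e.
Proof.
move=> e0 cc; have := cc (0, 0); rewrite /prop_for /continuous_at /=.
have -> : chart_inf fa finf 0 0 = finf by rewrite /chart_inf eqxx.
move=> /cvgrPdist_le/(_ e e0)/nbhs_ballP[d /= d0 hd].
(* [|1/z| < d] amounts to [|z|^2 > d^(-2)]; the added [1] makes the inequality strict. *)
exists (d ^- 2 + 1); first by rewrite addr_gt0// invr_gt0 exprn_gt0.
move=> x y hs; have s0 : 0 < x ^+ 2 + y ^+ 2.
  by apply: lt_le_trans hs; rewrite addr_gt0// invr_gt0 exprn_gt0.
rewrite (@chart_infE fa finf) ?gt_eqF// distrC.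
have small z : z ^+ 2 <= x ^+ 2 + y ^+ 2 -> `|z / (x ^+ 2 + y ^+ 2)| < d.
  move=> zs; rewrite -ltr_sqr ?nnegrE ?normr_ge0 ?(ltW d0)// real_normK ?num_real//.
  rewrite expr_div_n; apply: le_lt_trans (_ : (x ^+ 2 + y ^+ 2)^-1 < _).
    rewrite ler_pdivrMr ?exprn_gt0// (le_trans zs)//.
    by rewrite expr2 mulrA mulVf ?gt_eqF// mul1r.
  rewrite -[d ^+ 2]invrK ltf_pV2 ?posrE ?invr_gt0 ?exprn_gt0//.
  by apply: lt_le_trans hs; rewrite ltrDl.
apply: (hd (_, _)); split; rewrite /ball/= sub0r normrN; apply: small; rewrite ?sqrrN; nra.
Qed.

(** Chain rule for [w = 1/z], whose derivative [- 1 / z^2] has real part [(y^2 - x^2) / s^2] and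
    imaginary part [2xy / s^2]. Its modulus [1 / s] is the source of the gradient decay at
    infinity. *)
Lemma sphere_grad fa finf (x y : R) : C2_sphere fa finf -> x ^+ 2 + y ^+ 2 != 0 ->
  let s := x ^+ 2 + y ^+ 2 in let g := chart_inf fa finf in
  pdx fa x y = pdx g (x / s) (- y / s) * ((y ^+ 2 - x ^+ 2) / s ^+ 2) +
               pdy g (x / s) (- y / s) * (2 * x * y / s ^+ 2) /\
  pdy fa x y = pdx g (x / s) (- y / s) * (- (2 * x * y) / s ^+ 2) +
               pdy g (x / s) (- y / s) * ((y ^+ 2 - x ^+ 2) / s ^+ 2).
Proof.
move=> [[hf _] [hg [_ [_ [_ [cgx [cgy _]]]]]]] s0 s g.
have dgx (u v : R) := is_derive_pdx u v hg.
have dgy (u v : R) := is_derive_pdy u v hg.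
have s2 : s ^+ 2 != 0 by rewrite expf_neq0.
have cs : jcont (fun x y : R => x ^+ 2 + y ^+ 2) by jc.
split.
- have da : is_derive x 1 (fun t => t / (t ^+ 2 + y ^+ 2)) ((y ^+ 2 - x ^+ 2) / s ^+ 2).
    eapply is_derive_eq; first by der.
    by rewrite /= /s; field.
  have db : is_derive x 1 (fun t => - y / (t ^+ 2 + y ^+ 2)) (2 * x * y / s ^+ 2).
    eapply is_derive_eq; first by der.
    by rewrite /= /s; field.
  have dc := chain_rule2 dgx dgy cgx cgy da db.
  have fE : \forall t \near x, g (t / (t ^+ 2 + y ^+ 2)) (- y / (t ^+ 2 + y ^+ 2)) = fa t y.
    have := @jcont_sectx _ _ y cs x; rewrite /continuous_at/= => /cvgr_neq0/(_ s0).
    by apply: filterS => t ht; apply/esym; exact: chart_infE ht.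
  by have [_ <-] := is_derive_pdx x y hf; have [_ <-] := near_eq_is_derive fE dc.
- have da : is_derive y 1 (fun t => x / (x ^+ 2 + t ^+ 2)) (- (2 * x * y) / s ^+ 2).
    eapply is_derive_eq; first by der.
    by rewrite /= /s; field.
  have db : is_derive y 1 (fun t => - t / (x ^+ 2 + t ^+ 2)) ((y ^+ 2 - x ^+ 2) / s ^+ 2).
    eapply is_derive_eq; first by der.
    by rewrite /= /s; field.
  have dc := chain_rule2 dgx dgy cgx cgy da db.
  have fE : \forall t \near y, g (x / (x ^+ 2 + t ^+ 2)) (- t / (x ^+ 2 + t ^+ 2)) = fa x t.
    have := @jcont_secty _ _ x cs y; rewrite /continuous_at/= => /cvgr_neq0/(_ s0).
    by apply: filterS => t ht; apply/esym; exact: chart_infE ht.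
  by have [_ <-] := is_derive_pdy x y hf; have [_ <-] := near_eq_is_derive fE dc.
Qed.

(** The closed unit discs of the two charts cover the sphere, so compactness bounds the function and
    its gradient. The bound on the Laplacian is the hypothesis on [M]. *)
Lemma C2_sphere_tame fa finf M : C2_sphere fa finf ->
  (forall x y, `|lap_sphere fa x y| <= M) ->
  tame fa (fun x y => pdx (pdx fa) x y + pdy (pdy fa) x y).
Proof.
move=> sf hM; have [C2f C2g] := sf.
have jf := C2_jet C2f; have jg := C2_jet C2g.
have [_ _ _ _ [cf cfx cfy _ _]] := jf; have [_ _ _ _ [cg cgx cgy _ _]] := jg.
have [A hA] := jcont_box_bounded 1 cf; have [A' hA'] := jcont_box_bounded 1 cg.
have [X hX] := jcont_box_bounded 1 cfx; have [X' hX'] := jcont_box_bounded 1 cgx.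
have [Y hY] := jcont_box_bounded 1 cfy; have [Y' hY'] := jcont_box_bounded 1 cgy.
have o1 : `|0 : R| <= 1 by rewrite normr0.
have pA : 0 <= A := le_trans (normr_ge0 _) (hA 0 0 o1 o1).
have pA' : 0 <= A' := le_trans (normr_ge0 _) (hA' 0 0 o1 o1).
have pX : 0 <= X := le_trans (normr_ge0 _) (hX 0 0 o1 o1).
have pX' : 0 <= X' := le_trans (normr_ge0 _) (hX' 0 0 o1 o1).
have pY : 0 <= Y := le_trans (normr_ge0 _) (hY 0 0 o1 o1).
have pY' : 0 <= Y' := le_trans (normr_ge0 _) (hY' 0 0 o1 o1).
have le1 (z w : R) : z ^+ 2 + w ^+ 2 <= 1 -> `|z| <= 1.
  by move=> zw; rewrite -(@expr_le1 _ 2)// real_normK ?num_real//; nra.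
have inv1 (z w : R) : 1 <= z ^+ 2 + w ^+ 2 -> `|z / (z ^+ 2 + w ^+ 2)| <= 1.
  move=> zw; rewrite -(@expr_le1 _ 2)// real_normK ?num_real// expr_div_n.
  by rewrite ler_pdivrMr ?mul1r; nra.
(* The factor [2] serves both charts: [1 + |z|^2] is at most [2] inside the unit disc and at most
   [2 |z|^2] outside. *)
pose C1 := 2 * (X + Y + X' + Y').
have C10 : 0 <= C1 by rewrite mulr_ge0 ?addr_ge0.
have near0 (x y d Z : R) : x ^+ 2 + y ^+ 2 <= 1 -> `|d| <= Z -> Z <= X + Y + X' + Y' ->
    `|d| <= C1 / (1 + x ^+ 2 + y ^+ 2).
  move=> s1 dZ ZC; rewrite ler_pdivlMr ?onesq_gt0// /C1.
  have := normr_ge0 d; have := sqr_ge0 x; have := sqr_ge0 y => *; nra.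
have far (x y p q r t : R) : 1 <= x ^+ 2 + y ^+ 2 ->
    `|p| <= X' -> `|q| <= Y' -> `|r| <= x ^+ 2 + y ^+ 2 -> `|t| <= x ^+ 2 + y ^+ 2 ->
    `|p * (r / (x ^+ 2 + y ^+ 2) ^+ 2) + q * (t / (x ^+ 2 + y ^+ 2) ^+ 2)|
      <= C1 / (1 + x ^+ 2 + y ^+ 2).
  set s := x ^+ 2 + y ^+ 2 => s1 pX'' qY' rs ts; have s0 : 0 < s by lra.
  have H (a b Z : R) : `|a| <= Z -> `|b| <= s -> `|a * (b / s ^+ 2)| <= Z / s.
    move=> aZ bs; rewrite normrM ler_pM// normrM normfV (gtr0_norm (exprn_gt0 _ s0)).
    by rewrite ler_pdivrMr ?exprn_gt0// expr2 mulrA mulVf ?gt_eqF// mul1r.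
  rewrite (le_trans (ler_normD _ _))// (le_trans (lerD (H _ _ _ pX'' rs) (H _ _ _ qY' ts)))//.
  rewrite -mulrDl ler_pdivrMr// mulrAC ler_pdivlMr; last by rewrite -addrA -/s; lra.
  rewrite -addrA -/s /C1; nra.
have qx (x y : R) : `|y ^+ 2 - x ^+ 2| <= x ^+ 2 + y ^+ 2.
  by rewrite ler_norml; apply/andP; split; nra.
have qxy (x y : R) : `|2 * x * y| <= x ^+ 2 + y ^+ 2.
  have := sqr_ge0 (x + y); have := sqr_ge0 (x - y).
  by rewrite ler_norml => *; apply/andP; split; lra.
have s0 (x y : R) : 1 <= x ^+ 2 + y ^+ 2 -> x ^+ 2 + y ^+ 2 != 0.
  by move=> h; rewrite gt_eqF//; lra.
have far_pt (x y : R) : 1 <= x ^+ 2 + y ^+ 2 ->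
    `|x / (x ^+ 2 + y ^+ 2)| <= 1 /\ `|- y / (x ^+ 2 + y ^+ 2)| <= 1.
  move=> h; split; first exact: inv1.
  by rewrite mulNr normrN [x ^+ 2 + _]addrC inv1// addrC.
apply: (tame_intro (C0 := A + A') (C1 := C1) (C2 := M) jf) => //.
- move=> x y; have [s1|/ltW s1] := leP (x ^+ 2 + y ^+ 2) 1.
    rewrite (le_trans (hA x y _ _)) ?lerDl//; first exact: le1 s1.
    by rewrite addrC in s1; exact: le1 s1.
  have [h1 h2] := far_pt x y s1.
  by rewrite (chart_infE fa finf (s0 _ _ s1)) (le_trans (hA' _ _ h1 h2))// lerDr.
- move=> x y; have [s1|/ltW s1] := leP (x ^+ 2 + y ^+ 2) 1.
    apply: (near0 _ _ _ X) => //; last by lra.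
    by apply: hX; [exact: le1 s1|rewrite addrC in s1; exact: le1 s1].
  have [h1 h2] := far_pt x y s1.
  have [-> _] := sphere_grad sf (s0 _ _ s1).
  by apply: far => //; [exact: hX'|exact: hY'].
- move=> x y; have [s1|/ltW s1] := leP (x ^+ 2 + y ^+ 2) 1.
    apply: (near0 _ _ _ Y) => //; last by lra.
    by apply: hY; [exact: le1 s1|rewrite addrC in s1; exact: le1 s1].
  have [h1 h2] := far_pt x y s1.
  have [_ ->] := sphere_grad sf (s0 _ _ s1).
  by apply: far => //; [exact: hX'|exact: hY'|rewrite normrN].
- move=> x y; have := hM x y; rewrite /lap_sphere /sdens; set s := 1 + _ + _.
  have s0' : 0 < s by exact: onesq_gt0.
  rewrite normrM gtr0_norm ?divr_gt0 ?exprn_gt0// => h.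
  have -> : M * (4 / s ^+ 2) = M / (s ^+ 2 / 4) by field; rewrite gt_eqF.
  by rewrite ler_pdivlMr ?divr_gt0 ?exprn_gt0// mulrC.
Qed.

End SphereFunctions.

(** * Point masses *)

Section PointKernel.
Variable R : realType.
Implicit Types (a : option R[i]) (eps : R).
Notation sdens := (@sdens R).
Notation onesq x y := (1 + x ^+ 2 + y ^+ 2).

(* [pdist a z / (1 + |z|^2)] is, up to a constant factor, the squared chordal
   distance from [z] to [a]; [None] is the point at infinity. *)
Definition pdist a (x y : R) : R :=
  if a is Some r then (x - complex.Re r) ^+ 2 + (y - complex.Im r) ^+ 2 else 1.

Definition pquad eps a x y : R := eps * onesq x y + pdist a x y.

(** The discriminant [4AD - B^2 - C^2] of the quadratic function [pquad eps a]. Hence [prho] is the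
    Laplacian of [ln (pquad eps a)], a smooth approximation of [4 pi] times the Dirac mass at
    [a]. *)
Definition pmass eps a : R :=
  if a is Some r then 4 * eps * (1 + eps + sqmod r) else 4 * eps * (1 + eps).

Definition prho eps a x y : R := pmass eps a / pquad eps a x y ^+ 2.

Definition plog eps a x y : R := ln (pquad eps a x y) - ln (onesq x y).

Lemma sqmod_ge0 (r : R[i]) : 0 <= sqmod r.
Proof. by rewrite addr_ge0 ?sqr_ge0. Qed.

Lemma pdist_ge0 a x y : 0 <= pdist a x y.
Proof. by case: a => [r|] //=; rewrite addr_ge0 ?sqr_ge0. Qed.

Lemma pquad_gt0 eps a x y : 0 < eps -> 0 < pquad eps a x y.
Proof. by move=> e0; rewrite ltr_wpDr ?pdist_ge0// mulr_gt0// onesq_gt0. Qed.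

Lemma pmass_ge0 eps a : 0 < eps -> 0 <= pmass eps a.
Proof.
move=> /ltW e0; case: a => [r|] /=; rewrite mulr_ge0 ?(mulr_ge0 _ e0)//.
  exact: addr_ge0 (addr_ge0 ler01 e0) (sqmod_ge0 r).
exact: addr_ge0 ler01 e0.
Qed.

Lemma prho_ge0 eps a x y : 0 < eps -> 0 <= prho eps a x y.
Proof. by move=> e0; rewrite divr_ge0 ?sqr_ge0// pmass_ge0. Qed.

Lemma tame_plog eps a : 0 < eps ->
  tame (plog eps a) (fun x y => prho eps a x y - sdens x y).
Proof.
move=> e0.
have qE : exists A B C D, (forall x y, quad A B C D x y = pquad eps a x y) /\
    4 * A * D - B ^+ 2 - C ^+ 2 = pmass eps a.
  case: a => [r|].
    exists (1 + eps), (- 2 * complex.Re r), (- 2 * complex.Im r), (eps + sqmod r).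
    by split=> [x y|]; rewrite /quad /pquad /= /sqmod; ring.
  exists eps, 0, 0, (1 + eps).
  by split=> [x y|]; rewrite /quad /pquad /=; ring.
have [A [B [C [D [qE1 qE2]]]]] := qE.
apply: (tame_eq (f := fun x y => ln (quad A B C D x y) - ln (onesq x y))
  (L := fun x y => (4 * A * D - B ^+ 2 - C ^+ 2) / quad A B C D x y ^+ 2 - sdens x y)).
- by apply/funext => x; apply/funext => y; rewrite qE1.
- by move=> x y; rewrite qE1 qE2.
apply: (tame_ln_quad e0) => x y.
by rewrite qE1 /pquad lerDl pdist_ge0.
Qed.

Lemma tdom_prho eps a : 0 < eps -> tdom (prho eps a).
Proof.
move=> e0; have := tdomD (tame_tdom (tame_plog a e0)) (@tdom_sdens R).
by congr tdom; apply/funext => x; apply/funext => y; rewrite subrK.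
Qed.

(** [prho - sdens] is the Laplacian of a tame function, so for every [eps] and every [a], infinity
    included, the mass is that of the sphere. *)
Lemma pint_prho eps a : 0 < eps -> pint (prho eps a) = 4 * pi.
Proof.
move=> e0; have tr := tdom_prho a e0.
have := pint_lap0 (tame_plog a e0).
have -> : (fun x y => prho eps a x y - sdens x y) =
    fun x y => prho eps a x y + -1 * sdens x y.
  by apply/funext => x; apply/funext => y; rewrite mulN1r.
have ts := @tdom_sdens R.
rewrite (pintD tr (tdomZ (-1) ts)) (pintZ (-1) ts) pint_sdens => h; lra.
Qed.

Definition sphere_val (fa : R -> R -> R) (finf : R) a : R :=
  if a is Some r then fa (complex.Re r) (complex.Im r) else finf.

(** Stating the distance through [pdist] compared with [1 + |z|^2] treats finite points and infinity
    uniformly: the far alternative is a lower bound on the chordal distance to [a]. *)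
Lemma close_or_far fa finf a e : 0 < e -> jcont fa -> jcont (chart_inf fa finf) ->
  exists2 kap, 0 < kap & forall x y,
    `|fa x y - sphere_val fa finf a| <= e \/ kap * onesq x y <= pdist a x y.
Proof.
move=> e0 cf cg; case: a => [r|]; last first.
  have [rho r0 hr] := jcont_chart_limit e0 cg.
  exists ((1 + rho)^-1); first by rewrite invr_gt0 addr_gt0.
  move=> x y; have [xy|xy] := leP rho (x ^+ 2 + y ^+ 2); first by left; exact: hr.
  by right; rewrite /= mulrC ler_pdivrMr ?addr_gt0// mul1r; lra.
have := cf (complex.Re r, complex.Im r); rewrite /prop_for /continuous_at/=.
move=> /cvgrPdist_le/(_ e e0)/nbhs_ballP[d /= d0 hd].
set u := complex.Re r in hd *; set v := complex.Im r in hd *.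
pose m := 1 + 2 * (u ^+ 2 + v ^+ 2).
have m0 : 0 < m by rewrite /m; nra.
(* [1 + |z|^2 <= m + 2 |z - a|^2], and [m <= |z - a|^2 m / d^2] as soon as [|z - a| >= d]. *)
pose K := m / d ^+ 2 + 2; have K0 : 0 < K by rewrite addr_gt0// divr_gt0// exprn_gt0.
exists K^-1; first by rewrite invr_gt0.
move=> x y; have [h|h] := ltP ((x - u) ^+ 2 + (y - v) ^+ 2) (d ^+ 2); [left|right].
  rewrite distrC; apply: (hd (x, y)).
  by split; rewrite /ball/= distrC -ltr_sqr ?nnegrE ?normr_ge0 ?(ltW d0)//
    real_normK ?num_real//; apply: le_lt_trans h; rewrite ?lerDl ?lerDr sqr_ge0.
rewrite mulrC ler_pdivrMr// /K mulrDr.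
have h1 : m <= ((x - u) ^+ 2 + (y - v) ^+ 2) * (m / d ^+ 2).
  by rewrite mulrCA ler_peMr ?(ltW m0)// ler_pdivlMr ?exprn_gt0// mul1r.
have := sqr_ge0 (x - 2 * u); have := sqr_ge0 (y - 2 * v).
move: h1; rewrite {1}/m => *; rewrite /= -/u -/v; lra.
Qed.

(** Approximate identity: near [a] the values of [fa] are close to the limit and the mass is [4 pi];
    away from [a] the kernel is at most a multiple of [eps * sdens]. *)
Lemma cvg_pint_prho fa finf a A : jcont fa -> jcont (chart_inf fa finf) ->
  (forall x y, `|fa x y| <= A) ->
  pint (fun x y => fa x y * prho eps a x y) @[eps --> 0^'+] -->
  4 * pi * sphere_val fa finf a.
Proof.
move=> cf cg fA; set v := sphere_val _ _ _.
have p0 : 0 < 4 * pi :> R by rewrite mulr_gt0// pi_gt0.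
apply/cvgrPdist_le => e e0.
have e1 : 0 < e / (2 * (4 * pi)) by rewrite divr_gt0// mulr_gt0.
have [kap k0 hk] := close_or_far a e1 cf cg.
pose W := A + `|v|; have W0 : 0 <= W by rewrite addr_ge0 ?normr_ge0 ?(le_trans _ (fA 0 0)).
(* [pmass eps a <= eps * D] when [eps <= 1]; [Q] below collects the constants of the far region,
   where the integrand is at most [eps * Q * sdens]. *)
pose D := if a is Some r then 4 * (2 + sqmod r) else 8.
have D0 : 0 <= D.
  by rewrite /D; case: (a) => [r|]; [have := sqmod_ge0 r; lra|].
pose Q := W * (D / (4 * kap ^+ 2)).
have Q0 : 0 <= Q by rewrite mulr_ge0// divr_ge0// mulr_ge0// sqr_ge0.
have Q1 : 0 < Q * (4 * pi) + 1 by rewrite ltr_wpDl// mulr_ge0// ltW.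
near=> eps.
have ep0 : 0 < eps by near: eps; exact: nbhs_right_gt.
have ep1 : eps <= 1 by near: eps; exact: nbhs_right_le.
have epQ : eps * Q * (4 * pi) <= e / 2.
  have h : eps <= e / 2 / (Q * (4 * pi) + 1).
    by near: eps; apply: nbhs_right_le; rewrite divr_gt0// divr_gt0.
  by move: h; rewrite ler_pdivlMr//; lra.
have tr := tdom_prho a ep0.
have tf : tdom (fun x y => fa x y * prho eps a x y) := tdomM cf fA tr.
have tv : tdom (fun x y => - v * prho eps a x y) := tdomZ (- v) tr.
have ts : tdom (fun x y => (eps * Q) * sdens x y) := tdomZ _ (@tdom_sdens R).
have te : tdom (fun x y => e / (2 * (4 * pi)) * prho eps a x y) := tdomZ _ tr.
rewrite distrC.
have -> : pint (fun x y => fa x y * prho eps a x y) - 4 * pi * v =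
  pint (fun x y => fa x y * prho eps a x y + - v * prho eps a x y).
  by rewrite pintD// pintZ// pint_prho//; ring.
apply: le_trans (pint_norm (tdomD tf tv) (tdomD te ts) _) _.
  move=> x y; have r0 := prho_ge0 a x y ep0.
  rewrite -mulrDl normrM (ger0_norm r0).
  have S0 : 0 <= eps * Q * sdens x y.
    exact: mulr_ge0 (mulr_ge0 (ltW ep0) Q0) (ltW (sdens_gt0 x y)).
  have [h|h] := hk x y.
    by rewrite -[leLHS]addr0 lerD// ler_wpM2r.
  rewrite -[leLHS]add0r lerD//; first by rewrite mulr_ge0// ltW.
  have vW : `|fa x y - v| <= W by rewrite (le_trans (ler_normB _ _))// lerD.
  have s0 := onesq_gt0 x y.
  have rh : prho eps a x y <= eps * (D / (4 * kap ^+ 2)) * sdens x y.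
    have -> : eps * (D / (4 * kap ^+ 2)) * sdens x y = eps * D / (kap * onesq x y) ^+ 2.
      by rewrite /sdens; field; rewrite !gt_eqF.
    rewrite /prho ler_pM ?pmass_ge0 ?invr_ge0 ?sqr_ge0//.
      rewrite /pmass /D; case: (a) => [r|]; last nra.
      by have := sqmod_ge0 r; nra.
    rewrite lef_pV2 ?posrE ?exprn_gt0 ?mulr_gt0 ?pquad_gt0//.
    rewrite lerXn2r ?nnegrE ?(ltW (pquad_gt0 _ _ _ ep0)) ?(ltW (mulr_gt0 k0 s0))//.
    by rewrite (le_trans h)// lerDr mulr_ge0// ltW.
  have -> : eps * Q * sdens x y = W * (eps * (D / (4 * kap ^+ 2)) * sdens x y).
    by rewrite /Q; ring.
  by rewrite ler_pM.
rewrite (pintD te ts) (pintZ _ tr) (pintZ _ (@tdom_sdens R)) pint_prho// pint_sdens.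
have half (p : R) : p != 0 -> e / (2 * p) * p = e / 2 by move=> pn; field.
by rewrite half ?gt_eqF//; lra.
Unshelve. all: by end_near. Qed.

End PointKernel.

(** * Discrepancy of a fiber *)

Section Products.
Variable R : realType.
Variables (I : Type).
Implicit Types (s : seq I) (f : I -> R) (e : R).

Lemma prod_ge0 s f : (forall i, 0 <= f i) -> 0 <= \prod_(i <- s) f i.
Proof. by move=> f0; apply: prodr_ge0 => i _. Qed.

(** The product is a polynomial in [e] with non-negative coefficients, hence convex on [[0, 1]], and
    the right-hand side is its chord there. *)
Lemma prod_addr_le s f e : (forall i, 0 <= f i) -> 0 <= e <= 1 ->
  \prod_(i <- s) (f i + e) <=
  \prod_(i <- s) f i + e * (\prod_(i <- s) (f i + 1) - \prod_(i <- s) f i).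
Proof.
move=> f0 /andP[e0 e1]; elim: s => [|i s IH]; first by rewrite !big_nil subrr mulr0 addr0.
rewrite !big_cons; have := prod_ge0 s f0.
have : \prod_(j <- s) f j <= \prod_(j <- s) (f j + 1).
  by apply: ler_prod => j _; rewrite f0/= lerDl.
move: IH; set p := \prod_(j <- s) f j; set q := \prod_(j <- s) (f j + 1).
set r := \prod_(j <- s) (f j + e) => IH pq p0.
have fi := f0 i; set a := f i in fi *.
apply: le_trans (_ : (a + e) * (p + e * (q - p)) <= _).
  by apply: ler_wpM2l => //; rewrite addr_ge0.
have : 0 <= e * (1 - e) * (q - p) by rewrite !mulr_ge0 ?subr_ge0.
by lra.
Qed.

(** Only the two extreme terms of the expansion in [e] are kept; they are distinct terms because the
    sequence is non-empty. *)
Lemma prod_addr_ge s f e : (forall i, 0 <= f i) -> 0 <= e -> (0 < size s)%N ->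
  \prod_(i <- s) f i + e ^+ size s <= \prod_(i <- s) (f i + e).
Proof.
move=> f0 e0; elim: s => // i [_ _|j s IH _].
  by rewrite !big_cons !big_nil !mulr1 expr1.
rewrite big_cons [leRHS]big_cons /= exprS.
have := IH isT; have := prod_ge0 (j :: s) f0; have fi := f0 i.
have eS : 0 <= e ^+ size (j :: s) by rewrite exprn_ge0.
move: eS; set p := \prod_(_ <- _) _; set q := e ^+ _; set r := \prod_(_ <- _) _ => q0 p0 pq.
apply: le_trans (_ : (f i + e) * (p + q) <= _); last by apply: ler_wpM2l => //; rewrite addr_ge0.
have : 0 <= f i * q by rewrite mulr_ge0.
have : 0 <= e * p by rewrite mulr_ge0.
by lra.
Qed.

Lemma sum_ln s f : (forall i, 0 < f i) ->
  \sum_(i <- s) ln (f i) = ln (\prod_(i <- s) f i).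
Proof.
move=> f0; elim: s => [|i s IH]; first by rewrite !big_nil ln1.
by rewrite !big_cons IH lnM ?posrE// prodr_gt0.
Qed.

End Products.

Section Core.
Variable R : realType.
Variables (H G : {poly R[i]}) (n : nat) (eta B : R).
Hypotheses (sH : (size H <= n.+2)%N) (sG : (size G <= n.+2)%N) (eta0 : 0 < eta).
Notation sdens := (@sdens R).
Notation onesq x y := (1 + x ^+ 2 + y ^+ 2).
Hypothesis annulus : forall x y : R,
  eta * onesq x y ^+ n.+1 <= normHG H G x y <= B * onesq x y ^+ n.+1.
Variables (c : R[i]) (rs : seq R[i]).
Hypotheses (c0 : c != 0) (Hrs : H = c *: \prod_(r <- rs) ('X - r%:P)).

Lemma sqmodM (z w : R[i]) : sqmod (z * w) = sqmod z * sqmod w.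
Proof. by rewrite /sqmod ReM ImM; ring. Qed.

Lemma sqmod1 : sqmod (1 : R[i]) = 1.
Proof. by rewrite /sqmod /= expr1n expr0n addr0. Qed.

Lemma sqmod_gt0 (z : R[i]) : z != 0 -> 0 < sqmod z.
Proof.
move=> z0; rewrite lt_neqAle sqmod_ge0 andbT eq_sym; apply: contra z0.
rewrite /sqmod paddr_eq0 ?sqr_ge0// !sqrf_eq0; case: z => a b /= /andP[/eqP-> /eqP->].
by [].
Qed.

(** The fiber as exactly [k = n + 1] points. A copy of infinity has [pdist] equal to [1], so it
    leaves the product over the roots unchanged but supplies its factor [1 / (1 + |z|^2)] in
    [prod_ratio]. *)
Definition points : seq (option R[i]) := map Some rs ++ nseq (n.+1 - size rs) None.

Lemma size_rs : (size rs <= n.+1)%N.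
Proof. by move: sH; rewrite Hrs size_scale// size_prod_XsubC. Qed.

Lemma size_points : size points = n.+1.
Proof. by rewrite size_cat size_map size_nseq subnKC// size_rs. Qed.

Lemma prod_pdist x y : sqmod c * \prod_(a <- points) pdist a x y = sqP H x y.
Proof.
rewrite big_cat /= big_map [X in _ * (_ * X)]big1_seq ?mulr1; last first.
  by move=> a /= /nseqP[-> _].
rewrite Hrs -[RHS]/(sqmod (c *: \prod_(r <- rs) ('X - r%:P)).[Complex x y]).
rewrite hornerZ sqmodM horner_prod; congr (_ * _).
elim: rs => [|r s IH]; first by rewrite !big_nil sqmod1.
rewrite !big_cons sqmodM IH; congr (_ * _).
by rewrite hornerXsubC /sqmod ReD ImD ReN ImN.
Qed.

Definition ratio x y (a : option R[i]) : R := pdist a x y / onesq x y.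

Lemma ratio_ge0 x y a : 0 <= ratio x y a.
Proof. by rewrite divr_ge0 ?pdist_ge0// ltW// onesq_gt0. Qed.

Lemma prod_ratio x y :
  sqmod c * \prod_(a <- points) ratio x y a = sqP H x y / onesq x y ^+ n.+1.
Proof.
rewrite -prod_pdist -size_points -mulrA; congr (_ * _).
elim: points => [|a s IH]; first by rewrite !big_nil expr0 divr1.
by rewrite !big_cons IH /ratio /= [onesq x y ^+ (size s).+1]exprS invfM mulrACA.
Qed.

Lemma ratio_bound a : exists K, forall x y, ratio x y a <= K.
Proof.
have s0 := @onesq_gt0 R.
case: a => [r|]; last first.
  exists 1 => x y; rewrite /ratio /= ler_pdivrMr// mul1r -addrA lerDl.
  by rewrite addr_ge0 ?sqr_ge0.
exists (2 * (1 + sqmod r)) => x y; rewrite /ratio /= ler_pdivrMr//.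
have := sqr_ge0 (x + complex.Re r); have := sqr_ge0 (y + complex.Im r).
have : 0 <= sqmod r * (x ^+ 2 + y ^+ 2) by rewrite mulr_ge0 ?sqmod_ge0// addr_ge0 ?sqr_ge0.
rewrite /sqmod; lra.
Qed.

Lemma prod_ratio1_bound : exists2 K, 0 <= K & forall x y,
  \prod_(a <- points) (ratio x y a + 1) <= K.
Proof.
elim: points => [|a s [K K0 hK]]; first by exists 1 => // x y; rewrite big_nil.
have [Ka hKa] := ratio_bound a.
have Ka0 : 0 <= Ka := le_trans (ratio_ge0 0 0 a) (hKa 0 0).
exists ((Ka + 1) * K); first by rewrite mulr_ge0// addr_ge0.
move=> x y; rewrite big_cons ler_pM ?lerD// ?addr_ge0 ?ratio_ge0//.
by apply: prod_ge0 => b; rewrite addr_ge0 ?ratio_ge0.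
Qed.

(* Regularisation of [log |H|^2 - k log (1 + |z|^2)]. *)
Definition Phi (eps x y : R) : R :=
  ln (sqmod c) + \sum_(a <- points) plog eps a x y.

Lemma PhiE eps x y : 0 < eps ->
  Phi eps x y = ln (sqmod c * \prod_(a <- points) (ratio x y a + eps)).
Proof.
move=> e0; have s0 := onesq_gt0 x y.
have f0 a : 0 < ratio x y a + eps by rewrite ltr_wpDl ?ratio_ge0.
rewrite lnM ?posrE ?sqmod_gt0 ?prodr_gt0//; congr (_ + _).
rewrite -sum_ln//; apply: eq_bigr => a _.
rewrite /plog -ln_div ?posrE ?pquad_gt0//; congr ln.
by rewrite /pquad /ratio; field; rewrite gt_eqF.
Qed.

Lemma tame_Phi eps : 0 < eps ->
  tame (Phi eps) (fun x y => \sum_(a <- points) prho eps a x y - n.+1%:R * sdens x y).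
Proof.
move=> e0.
have := tameD (tame_cst (ln (sqmod c)))
  (tame_sum points (fun a => tame_plog a e0)).
apply: tame_eq => // x y.
by rewrite add0r sumrB; congr (_ - _); rewrite big_const_seq count_predT size_points
  iter_addr_0 mulr_natl.
Qed.

Lemma B_gt0 : 0 < B.
Proof.
have /andP[h1 h2] := annulus 0 0.
move: (lt_le_trans (mulr_gt0 eta0 (exprn_gt0 n.+1 (onesq_gt0 0 0))) (le_trans h1 h2)).
by rewrite pmulr_lgt0// exprn_gt0// onesq_gt0.
Qed.

(** At [eps = 0] the product is at most [B]. The chord bound adds at most [eps] times a constant
    depending on the fiber, hence the slack [1] and the restriction to small [eps]. *)
Lemma Phi_le : \forall eps \near 0^'+, forall x y, Phi eps x y <= ln (B + 1).
Proof.
have [K K0 hK] := prod_ratio1_bound.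
have cc : 0 < sqmod c := sqmod_gt0 c0.
have cK : 0 < sqmod c * K + 1 by rewrite ltr_wpDl// mulr_ge0// ltW.
near=> eps.
have e0 : 0 < eps by near: eps; exact: nbhs_right_gt.
have e1 : eps <= 1 by near: eps; exact: nbhs_right_le.
have eK : eps * (sqmod c * K) <= 1.
  have h : eps <= 1 / (sqmod c * K + 1).
    by near: eps; apply: nbhs_right_le; rewrite divr_gt0.
  by move: h; rewrite ler_pdivlMr//; lra.
move=> x y; have s0 := onesq_gt0 x y; have sk0 := exprn_gt0 n.+1 s0.
have f0 a : 0 < ratio x y a + eps by rewrite ltr_wpDl ?ratio_ge0.
have P0 : 0 < \prod_(a <- points) (ratio x y a + eps) by exact: prodr_gt0.
rewrite PhiE// ler_ln ?posrE ?(mulr_gt0 cc P0) ?(addr_gt0 B_gt0 ltr01)//.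
have e01 : 0 <= eps <= 1 by rewrite (ltW e0).
have := prod_addr_le points (ratio_ge0 x y) e01.
have := prod_ge0 points (ratio_ge0 x y); have := hK x y.
have := prod_ratio x y.
set p := \prod_(a <- _) ratio x y a; set q := \prod_(a <- _) (_ + 1).
set r := \prod_(a <- _) (_ + eps) => pE qK p0 rpq.
have pB : sqmod c * p <= B.
  rewrite pE ler_pdivrMr//; have /andP[_] := annulus x y; apply: le_trans.
  by rewrite lerDl addr_ge0 ?sqr_ge0.
apply: le_trans (_ : sqmod c * (p + eps * K) <= _).
  rewrite ler_pM2l// (le_trans rpq)// lerD2l ler_pM2l//; lra.
by lra.
Unshelve. all: by end_near. Qed.

(** Chosen so that [eta * delta eps] is the term [|c|^2 eps^k] retained by [prod_addr_ge]:
    regularising [Phi] by [eps] then dominates regularising [log tau] by [delta eps]. *)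
Definition delta (eps : R) : R := sqmod c * eps ^+ n.+1 / eta.

Lemma delta_gt0 eps : 0 < eps -> 0 < delta eps.
Proof. by move=> e0; rewrite divr_gt0// mulr_gt0 ?sqmod_gt0// exprn_gt0. Qed.

Lemma Phi_ge eps x y : 0 < eps ->
  ln eta + ln (tauHG H G x y + delta eps) <= Phi eps x y.
Proof.
move=> e0; have s0 := onesq_gt0 x y; have sk0 := exprn_gt0 n.+1 s0.
have f0 a : 0 < ratio x y a + eps by rewrite ltr_wpDl ?ratio_ge0.
have d0 := delta_gt0 e0; have /andP[t0 _] := tauHG_bounds eta0 annulus x y.
rewrite PhiE// -lnM ?posrE// ?ltr_wpDl// ler_ln ?posrE; last 2 first.
- by rewrite mulr_gt0// ltr_wpDl.
- by rewrite mulr_gt0 ?prodr_gt0// sqmod_gt0.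
have h := @prod_addr_ge R _ points _ eps (ratio_ge0 x y) (ltW e0).
rewrite size_points in h.
apply: le_trans (_ : sqmod c * (\prod_(a <- points) ratio x y a + eps ^+ n.+1) <= _).
  rewrite [leRHS]mulrDr prod_ratio mulrDr lerD//; last first.
    by rewrite /delta mulrCA divff ?gt_eqF// mulr1.
  rewrite /tauHG ler_pdivlMr// mulrA mulrAC ler_pdivrMr ?(normHG_gt0 eta0 annulus)//.
  rewrite mulrAC [leRHS]mulrC ler_wpM2r ?addr_ge0 ?sqr_ge0//.
  by have /andP[] := annulus x y.
by rewrite ler_pM2l ?sqmod_gt0// h.
Qed.

Let k : R := n.+1%:R.
Let k0 : 0 < k.
Proof. by rewrite ltr0n. Qed.

Lemma tdomB (f g : R -> R -> R) : tdom f -> tdom g -> tdom (fun x y => f x y - g x y).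
Proof.
move=> tf tg; have := tdomD tf (tdomZ (-1) tg).
by congr tdom; apply/funext => x; apply/funext => y; rewrite mulN1r.
Qed.

Lemma pintB (f g : R -> R -> R) : tdom f -> tdom g ->
  pint (fun x y => f x y - g x y) = pint f - pint g.
Proof.
move=> tf tg; rewrite -[- pint g]mulN1r -pintZ// -pintD//; last exact: tdomZ.
by congr pint; apply/funext => x; apply/funext => y; rewrite mulN1r.
Qed.

Let tS : tdom (fun x y => k * sdens x y) := tdomZ k (@tdom_sdens R).
Let tame_ps := tame_psi sH sG eta0 annulus.

Lemma tdom_pullback : tdom (pullback H G).
Proof.
have := tdomD (tame_tdom tame_ps) tS.
by congr tdom; apply/funext => x; apply/funext => y; rewrite subrK.
Qed.

Lemma pint_pullback : pint (pullback H G) = 4 * pi * k.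
Proof.
have := pint_lap0 tame_ps; rewrite pintB//; last exact: tdom_pullback.
by rewrite pintZ ?pint_sdens; [lra|exact: tdom_sdens].
Qed.

(** The entropy Laplacian has integral zero, so it may be subtracted from the constant [ln eta - 3]
    times [pullback]. After division by [pullback] the claim becomes a pointwise inequality in [tau]
    and [delta]. *)
Lemma pint_Phi_pullback eps : 0 < eps ->
  (ln eta - 3) * (4 * pi * k) <= pint (fun x y => Phi eps x y * pullback H G x y).
Proof.
move=> e0; have d0 := delta_gt0 e0.
have tE := tame_entropy sH sG eta0 annulus d0.
have tPp := tdom_tameM (tame_Phi e0) tdom_pullback.
rewrite -pint_pullback -pintZ; last exact: tdom_pullback.
have tl := tdomZ (ln eta - 3) tdom_pullback.
rewrite -[leLHS]subr0 -(pint_lap0 tE) -pintB//; last exact: (tame_tdom tE).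
apply: le_pint => //; first exact: tdomB tl (tame_tdom tE).
move=> x y; have p0 := pullback_ge0 H G x y; rewrite [X in _ - X]mulrC -mulrBl ler_wpM2r//.
apply: le_trans (Phi_ge x y e0).
have /andP[] := tauHG_bounds eta0 annulus x y.
set t := tauHG H G x y; set d := delta eps in d0 * => t0 t1.
have td : 0 < t + d by rewrite ltr_wpDl.
(* Origin of the [3]: this bound gives [- 2 t ln (t + d) <= 2 t / (t + d) - 2 t <= 2], and the
   gradient term [t (1 - t) / (t + d)] is at most [1]. *)
have l1 : 1 - (t + d)^-1 <= ln (t + d).
  have h : ln (1 + ((t + d)^-1 - 1)) <= (t + d)^-1 - 1.
    by apply: le_ln1Dx; rewrite ltrBrDl subrr invr_gt0.
  by move: h; rewrite (_ : 1 + _ = (t + d)^-1) ?lnV ?posrE//; [lra|ring].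
have td1 : t / (t + d) <= 1 by rewrite ler_pdivrMr// mul1r lerDl ltW.
have td0 : 0 <= t / (t + d) by rewrite divr_ge0// ltW.
have h2 : t * (1 - (t + d)^-1) <= t * ln (t + d) by rewrite ler_wpM2l.
have h3 : t * (1 - t) / (t + d) = t / (t + d) - t * (t / (t + d)) by ring.
have h4 : t * (t / (t + d)) <= t by rewrite ler_piMr.
have h5 : 0 <= t * (t / (t + d)) by rewrite mulr_ge0.
rewrite h3; lra.
Qed.

(** Green's formula for [Phi] and [psi] trades the measure [k * sdens] for [pullback], whose
    integral against [Phi] is under control. Every term carries a factor [k], which cancels; one
    [ln eta] comes from the range of [psi], the other from [pint_Phi_pullback]. *)
Lemma pint_Phi_lower eps : 0 < eps ->
  - pint (fun x y => Phi eps x y * sdens x y) <= 4 * pi * (ln B - 2 * ln eta + 3).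
Proof.
move=> e0; have pp : 0 < 4 * pi :> R by rewrite mulr_gt0// pi_gt0.
have tP := tame_Phi e0.
have tPs := tdom_tameM tP (@tdom_sdens R).
have tPp := tdom_tameM tP tdom_pullback.
have tps := tameD tame_ps (tame_cst (- ln B)).
have := green tP tps.
have -> : (fun x y => Phi eps x y * (pullback H G x y - n.+1%:R * sdens x y + 0)) =
  fun x y => Phi eps x y * pullback H G x y - k * (Phi eps x y * sdens x y).
  by apply/funext => x; apply/funext => y; rewrite /k; ring.
rewrite pintB// ?pintZ//; last exact: tdomZ.
have tr := tdom_tameM tps (tame_tdom tP).
have ub : pint (fun x y => (psiHG H G n x y - ln B) *
    (\sum_(a <- points) prho eps a x y - n.+1%:R * sdens x y)) <=
    k * (ln B - ln eta) * (4 * pi).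
  rewrite -(pint_sdens R) -pintZ; last exact: tdom_sdens.
  apply: le_pint => //; first exact: tdomZ (@tdom_sdens R).
  move=> x y; have /andP[h1 h2] := psiHG_bounds eta0 annulus x y.
  have r0 : 0 <= \sum_(a <- points) prho eps a x y by apply: sumr_ge0 => a _; exact: prho_ge0.
  have s0 := sdens_gt0 x y; rewrite -/k.
  move: (\sum_(a <- _) _) r0 => r r0; move: (psiHG _ _ _ _ _) h1 h2 => u h1 h2.
  have : 0 <= (ln B - u) * r by rewrite mulr_ge0 ?subr_ge0.
  have : 0 <= (u - ln eta) * (k * sdens x y).
    by apply: mulr_ge0 (mulr_ge0 (ltW k0) (ltW s0)); rewrite subr_ge0.
  by lra.
have lb := pint_Phi_pullback e0.
move=> E; rewrite -(ler_pM2l k0); move: ub lb; rewrite -E; lra.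
Qed.

(** For fixed [eps] the discrepancy is the integral of [Phi] against the Laplacian of [fa]. It is
    bounded through the integral of [ln (B + 1) - Phi], which is non-negative for small [eps]. *)
Theorem equidistribution fa finf M : C2_sphere fa finf ->
  (forall x y, `|lap_sphere fa x y| <= M) ->
  `|4 * pi * \sum_(a <- points) sphere_val fa finf a
    - k * pint (fun x y => fa x y * sdens x y)|
  <= M * (4 * pi * (ln (B + 1) + ln B - 2 * ln eta + 3)).
Proof.
move=> sf hM; have tf := C2_sphere_tame sf hM.
have cf : jcont fa := tame_jcont tf.
have cg : jcont (chart_inf fa finf) by case: sf => _ [_ [_ [_ []]]].
have [A fA] := tame_bounded tf.
have pp : 0 < 4 * pi :> R by rewrite mulr_gt0// pi_gt0.
have M0 : 0 <= M := le_trans (normr_ge0 _) (hM 0 0).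
have tfs := tdom_tameM tf (@tdom_sdens R).
pose L x y := pdx (pdx fa) x y + pdy (pdy fa) x y.
have tL : tdom L := tame_tdom tf.
have LM x y : `|L x y| <= M * sdens x y.
  have := hM x y; rewrite /lap_sphere -/(L x y) /sdens; set s := 1 + _ + _.
  have s0' : 0 < s by exact: onesq_gt0.
  rewrite normrM gtr0_norm ?divr_gt0 ?exprn_gt0// => h.
  have -> : M * (4 / s ^+ 2) = M / (s ^+ 2 / 4) by field; rewrite gt_eqF.
  by rewrite ler_pdivlMr ?divr_gt0 ?exprn_gt0// mulrC.
(* The estimate obtained below does not depend on [eps], so it passes to this limit. *)
have cv : (\sum_(a <- points) pint (fun x y => fa x y * prho eps a x y) -
    k * pint (fun x y => fa x y * sdens x y)) @[eps --> 0^'+] -->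
    4 * pi * \sum_(a <- points) sphere_val fa finf a -
      k * pint (fun x y => fa x y * sdens x y).
  apply: cvgB; last exact: cvg_cst.
  rewrite mulr_sumr; elim: points => [|a s IH].
    by rewrite big_nil; under eq_fun do rewrite big_nil; exact: cvg_cst.
  rewrite big_cons; under eq_fun do rewrite big_cons.
  by apply: cvgD => //; exact: cvg_pint_prho fA.
apply: (cvgr_to_le (cvg_norm cv)); near=> eps.
have e0 : 0 < eps by near: eps; exact: nbhs_right_gt.
have Phile : forall x y, Phi eps x y <= ln (B + 1) by near: eps; exact: Phi_le.
have tP := tame_Phi e0.
have tfr a : tdom (fun x y => fa x y * prho eps a x y) := tdom_tameM tf (tdom_prho a e0).
have tPs := tdom_tameM tP (@tdom_sdens R).
have tPL := tdom_tameM tP tL.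
(* Green's formula moves the Laplacian from [Phi] to [fa]; the term with [ln (B + 1)] integrates to
   zero and gives the factor its sign. *)
have -> : \sum_(a <- points) pint (fun x y => fa x y * prho eps a x y) -
    k * pint (fun x y => fa x y * sdens x y) =
    - pint (fun x y => ln (B + 1) * L x y - Phi eps x y * L x y).
  rewrite pintB//; last exact: tdomZ.
  rewrite pintZ// (pint_lap0 tf) mulr0 sub0r opprK (green tP tf).
  rewrite -pint_sum// -pintZ// -pintB//; [|exact: tdom_sum|exact: tdomZ].
  congr pint; apply/funext => x; apply/funext => y.
  by rewrite mulrBr mulr_sumr /k; congr (_ - _); ring.
pose g x y := M * (ln (B + 1) * sdens x y - Phi eps x y * sdens x y).
rewrite normrN; apply: le_trans (pint_norm (g := g) _ _ _) _; rewrite /g.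
- by apply: tdomB => //; exact: tdomZ.
- by apply: tdomZ; apply: tdomB => //; exact: tdomZ (@tdom_sdens R).
- move=> x y; rewrite -!mulrBl normrM ger0_norm ?subr_ge0//.
  by rewrite mulrCA ler_wpM2l ?subr_ge0.
rewrite pintZ; last by apply: tdomB => //; exact: tdomZ (@tdom_sdens R).
rewrite pintB//; last exact: tdomZ (@tdom_sdens R).
rewrite pintZ ?pint_sdens; last exact: tdom_sdens.
rewrite ler_wpM2l//; have := pint_Phi_lower e0; lra.
Unshelve. all: by end_near. Qed.

End Core.

(** * From homogeneous pairs on the three-sphere to the affine chart, and the final estimate *)

Section Main.
Variable R : realType.
Notation onesq x y := (1 + x ^+ 2 + y ^+ 2).

Lemma sqmodX (z : R[i]) k : sqmod (z ^+ k) = sqmod z ^+ k.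
Proof. by elim: k => [|k IH]; rewrite ?expr0 ?sqmod1// !exprS sqmodM IH. Qed.

Lemma homog_scale k (P : {poly R[i]}) (z t : R[i]) : (size P <= k.+1)%N ->
  homog k P (z * t) t = P.[z] * t ^+ k.
Proof.
move=> sP; rewrite (horner_coef_wide z sP) /homog mulr_suml; apply: eq_bigr => j _.
by rewrite exprMn -!mulrA -exprD subnKC// -ltnS.
Qed.

Lemma annulus_affine k (P Q : {poly R[i]}) (eta : R) :
  (size P <= k.+1)%N -> (size Q <= k.+1)%N ->
  (forall z0 z1 : R[i], sqmod z0 + sqmod z1 = 1 ->
     eta <= sqmod (homog k P z0 z1) + sqmod (homog k Q z0 z1) <= 1) ->
  forall x y, eta * onesq x y ^+ k <= sqP P x y + sqP Q x y <= onesq x y ^+ k.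
Proof.
move=> sP sQ hPQ x y; have s0 := onesq_gt0 x y; have sk0 := exprn_gt0 k s0.
(* [(z t, t)] is the representative of [z] on the unit sphere; homogeneity turns the factor
   [|t|^(2k)] into [(1 + |z|^2)^(-k)]. *)
pose t : R[i] := Complex (Num.sqrt (onesq x y))^-1 0.
have tE : sqmod t = (onesq x y)^-1.
  by rewrite /sqmod /= expr0n addr0 exprVn sqr_sqrtr// ltW.
have := hPQ (Complex x y * t) t; rewrite !homog_scale// !sqmodM sqmodX tE.
have -> : sqmod (Complex x y) = x ^+ 2 + y ^+ 2 by [].
have -> : (x ^+ 2 + y ^+ 2) * (onesq x y)^-1 + (onesq x y)^-1 = 1.
  by field; rewrite gt_eqF.
move=> /(_ erefl); rewrite -mulrDl exprVn ler_pdivlMr// ler_pdivrMr// mul1r.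
by [].
Qed.

Lemma fiber_sum_points n fa finf (rs : seq R[i]) :
  fiber_sum n.+1 fa finf rs = \sum_(a <- points n rs) sphere_val fa finf a.
Proof.
rewrite /fiber_sum big_cat big_map /=; congr (_ + _).
by elim: (n.+1 - size rs)%N => [|m IH]; rewrite ?big_nil ?mul0r//=
  big_cons -IH mulrS mulrDl mul1r.
Qed.

Lemma fiber_discrepancy n (H G : {poly R[i]}) (eta B : R) :
  0 < eta -> (size H <= n.+2)%N -> (size G <= n.+2)%N ->
  (forall x y, eta * onesq x y ^+ n.+1 <= normHG H G x y <= B * onesq x y ^+ n.+1) ->
  forall (fa : R -> R -> R) (finf : R), C2_sphere fa finf ->
  forall (c : R[i]) (rs : seq R[i]), c != 0 ->
    H = c *: \prod_(r <- rs) ('X - r%:P) ->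
  forall M : R, (forall x y : R, `|lap_sphere fa x y| <= M) ->
  `| fiber_sum n.+1 fa finf rs / n.+1%:R - sphere_integral fa / (4 * pi) |
    <= (ln (B + 1) + ln B - 2 * ln eta + 3) * M / n.+1%:R.
Proof.
move=> eta0 sH sG ann fa finf sf c rs c0 Hrs M hM.
have := equidistribution sH sG eta0 ann c0 Hrs sf hM.
rewrite -fiber_sum_points -[pint _]/(sphere_integral fa).
have pp : 0 < 4 * pi :> R by rewrite mulr_gt0// pi_gt0.
have k0 : 0 < n.+1%:R :> R by rewrite ltr0n.
move: (4 * pi) pp (n.+1%:R) k0 => p p0 k k0.
move: (fiber_sum _ _ _ _) (sphere_integral _) (ln _ + _ - _ + _) => S I C h.
have -> : S / k - I / p = (p * S - k * I) / (p * k) by field; rewrite !gt_eqF.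
rewrite normrM normfV (gtr0_norm (mulr_gt0 p0 k0)) ler_pdivrMr ?mulr_gt0//.
have -> : C * M / k * (p * k) = M * (p * C) by field; rewrite gt_eqF.
by [].
Qed.

End Main.

Theorem theorem2 (R : realType) (eta : R) (P Q : nat -> {poly R[i]}) (k0 : nat) :
  0 < eta <= 1 ->
  (forall k : nat, (k0 <= k)%N ->
     (size (P k) <= k.+1)%N /\ (size (Q k) <= k.+1)%N) ->
  (forall k : nat, (k0 <= k)%N -> forall z0 z1 : R[i],
     sqmod z0 + sqmod z1 = 1 ->
     eta <= sqmod (homog k (P k) z0 z1) + sqmod (homog k (Q k) z0 z1) <= 1) ->
  forall w : option R[i], exists Cst : R, exists K : nat,
    forall k : nat, (K <= k)%N ->
    forall (fa : R -> R -> R) (finf : R), C2_sphere fa finf ->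
    forall (c : R[i]) (rs : seq R[i]), c != 0 ->
      fiber_poly (P k) (Q k) w = c *: \prod_(r <- rs) ('X - r%:P) ->
    forall M : R, (forall x y : R, `|lap_sphere fa x y| <= M) ->
      `| fiber_sum k fa finf rs / k%:R - sphere_integral fa / (4 * pi) |
        <= Cst * M / k%:R.
Proof.
move=> /andP[eta0 _] sPQ hPQ w.
(* [1 + |a|^2] is the factor by which the pair [(H, G)] below rescales [|P|^2 + |Q|^2]. In the
   constant, [ln (B + 1)] is the upper bound of [Phi] and the rest comes from [pint_Phi_lower]. *)
pose B : R := if w is Some a then 1 + sqmod a else 1.
exists (ln (B + 1) + ln B - 2 * ln eta + 3), (maxn k0 1).
(* Degree [0] is excluded by the [maxn], so that [k = n + 1] throughout. *)
move=> [|n]; first by rewrite geq_max ltnn andbF.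
rewrite geq_max => /andP[kn _] fa finf sf c rs c0 Hrs M hM.
have [sP sQ] := sPQ _ kn.
have ann := annulus_affine sP sQ (hPQ _ kn).
case: w @B Hrs => [a|] B Hrs; last first.
  apply: (fiber_discrepancy (G := P n.+1) eta0 sQ sP _ sf c0 Hrs hM) => x y.
  rewrite /normHG [sqP (Q n.+1) x y + _]addrC /B mul1r; exact: ann.
(* [(P - a Q, conj a P + Q)] is [sqrt (1 + |a|^2)] times a unitary transform of [(P, Q)]. The lower
   bound [eta] persists because the factor is at least [1]. *)
pose abar : R[i] := Complex (complex.Re a) (- complex.Im a).
pose G := abar%:P * P n.+1 + Q n.+1.
have sC (b : R[i]) (S : {poly R[i]}) : (size S <= n.+2)%N -> (size (b%:P * S)%R <= n.+2)%N.
  by move=> sS; rewrite mul_polyC (leq_trans (size_scale_leq _ _)).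
have sH : (size (fiber_poly (P n.+1) (Q n.+1) (Some a)) <= n.+2)%N.
  by rewrite (leq_trans (size_polyD _ _))// geq_max sP size_polyN sC.
have sG : (size G <= n.+2)%N.
  by rewrite (leq_trans (size_polyD _ _))// geq_max sQ sC.
apply: (fiber_discrepancy (G := G) eta0 sH sG _ sf c0 Hrs hM) => x y.
have -> : normHG (fiber_poly (P n.+1) (Q n.+1) (Some a)) G x y =
    (1 + sqmod a) * (sqP (P n.+1) x y + sqP (Q n.+1) x y).
  rewrite /normHG /sqP /reP /imP /fiber_poly /G !hornerE.
  by rewrite !(ReD, ImD, ReN, ImN, ReM, ImM) /sqmod /abar /=; ring.
have /andP[h1 h2] := ann x y; have a0 := sqmod_ge0 a.
have s0 : 0 <= sqP (P n.+1) x y + sqP (Q n.+1) x y.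
  by rewrite !addr_ge0 ?sqr_ge0.
rewrite (le_trans h1) ?ler_peMl ?lerDl//=.
by rewrite ler_wpM2l// addr_ge0.
Qed.
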